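(* Let $Q\ge 2$ be a fixed integer and let $\rho\in(0,1/2]$ be a fixed real. For a positive integer $\kappa$, let $n=\lfloor \rho\kappa Q\rfloor$. For the congestion dynamics $\{\sigma(t)\}_{t\in\mathbb{Z}_+}$ on $\mathcal{S}_n$, the following holds: for each $\varepsilon\in(0,1)$ there exist constants $C_\varepsilon$ and $N_\varepsilon$ such that for all $n\ge N_\varepsilon$, $$\left|T^{\mathrm{mix}}(\varepsilon)-\frac12 n\log n\right|\le C_\varepsilon\, n .$$
   Context: Let $Q,\kappa$ be positive integers, $S=\{1,\dots,Q\}$, $N=\kappa Q$, $\rho\in(0,1)$ and $n=\lfloor\rho N\rfloor$ (with $n\ge1$), $[n]=\{1,\dots,n\}$, $\mathbb{Z}_+=\{0,1,2,\dots\}$. For $\sigma=(\sigma_i)_{i\in[n]}\in S^n$ let $\xi_v(\sigma)=\#\{i\in[n]:\sigma_i=v\}$ for $v\in S$. The configuration space is $\mathcal{S}_n=\{\sigma\in S^n:\ \xi_v(\sigma)\le\kappa\ \text{for all } v\in S\}$. Let $\varphi(s)=\log(\kappa+1)-\log(\kappa+1-s)$ for $s\in\{0,\dots,\kappa\}$, $\Phi(\sigma)=\sum_{v\in S}\sum_{s=0}^{\xi_v(\sigma)}\varphi(s)$, and let $\mu_n(\sigma)=Z_n^{-1}e^{-\Phi(\sigma)}$, $Z_n=\sum_{\sigma\in\mathcal{S}_n}e^{-\Phi(\sigma)}$, be the Gibbs distribution on $\mathcal{S}_n$. The congestion dynamics $\{\sigma(t)\}_{t\in\mathbb{Z}_+}$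 is the discrete-time Glauber dynamics for $\mu_n$: from $\sigma$, choose $i\in[n]$ uniformly at random and replace $\sigma$ by $\sigma'$ sampled from $\mu_n$ conditioned on $\sigma'_j=\sigma_j$ for all $j\ne i$. Equivalently, if $\sigma'$ differs from $\sigma$ exactly at coordinate $i$ and $\sigma'_i=v_1\neq\sigma_i$, then the transition probability is $p(\sigma,\sigma')=\frac{\kappa-\xi_{v_1}(\sigma)}{n(1+N-n)}$, and $p(\sigma,\sigma)=\sum_{i=1}^n\frac{1+\kappa-\xi_{\sigma_i}(\sigma)}{n(1+N-n)}$. The chain is irreducible, aperiodic and reversible with unique stationary distribution $\mu_n$. $\mathbf{P}_{\sigma_0}$ denotes the law of the chain started from $\sigma_0$. $D_{\mathrm{TV}}(t)=\max_{\sigma_0\in\mathcal{S}_n}\max_{A\subset\mathcal{S}_n}|\mathbf{P}_{\sigma_0}(\sigma(t)\in A)-\mu_n(A)|$ and $T^{\mathrm{mix}}(\varepsilon)=\min\{t\ge0: D_{\mathrm{TV}}(t)\le\varepsilon\}$. Constants may depend on the fixed parameters $Q$ and $\rho$. *)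

(* Defs.v *)
From HB Require Import structures.
From mathcomp Require Import all_boot all_order all_algebra.
From mathcomp Require Import all_classical all_reals all_analysis.

Set Implicit Arguments.
Unset Strict Implicit.
Unset Printing Implicit Defensive.

Import Order.TTheory GRing.Theory Num.Theory.
Local Open Scope ring_scope.

(* The set of stations {1, ..., Q} is represented by 'I_Q. *)

Definition occupancy (Q n : nat) (s : {ffun 'I_n -> 'I_Q}) (v : 'I_Q) : nat :=
  #|[set i : 'I_n | s i == v]|.

Definition config (Q kappa n : nat) : finType :=
  {s : {ffun 'I_n -> 'I_Q} | [forall v : 'I_Q, (occupancy s v <= kappa)%N]}.

Definition phi (R : realType) (kappa s : nat) : R :=
  ln (kappa.+1%:R) - ln (kappa.+1%:R - s%:R).

Definition energy (R : realType) (Q kappa n : nat) (s : config Q kappa n) : R :=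
  \sum_(v < Q) \sum_(0 <= k < (occupancy (val s) v).+1) phi R kappa k.

Definition partition_function (R : realType) (Q kappa n : nat) : R :=
  \sum_(s : config Q kappa n) expR (- energy R s).

Definition gibbs (R : realType) (Q kappa n : nat) (s : config Q kappa n) : R :=
  expR (- energy R s) / partition_function R Q kappa n.

Definition agree_off (Q kappa n : nat) (i : 'I_n) (s s' : config Q kappa n) : bool :=
  [forall j : 'I_n, (j != i) ==> (val s' j == val s j)].

(* Conditional law of a [gibbs]-distributed configuration s', given that s'
   agrees with s outside coordinate i. *)
Definition gibbs_cond (R : realType) (Q kappa n : nat) (i : 'I_n)
    (s s' : config Q kappa n) : R :=
  if agree_off i s s'
  then gibbs R s' / \sum_(r : config Q kappa n | agree_off i s r) gibbs R r
  else 0.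

Definition glauber (R : realType) (Q kappa n : nat) (s s' : config Q kappa n) : R :=
  \sum_(i < n) n%:R^-1 * gibbs_cond R i s s'.

(* [law_at R t s0 s] is the probability that the chain started from s0 is in
   state s at time t. *)
Fixpoint law_at (R : realType) (Q kappa n : nat) (t : nat)
    (s0 s : config Q kappa n) : R :=
  if t is t'.+1 then \sum_(r : config Q kappa n) law_at R t' s0 r * glauber R r s
  else (s == s0)%:R.

(* The maxima are over nonnegative reals, so that the unit 0 is harmless. *)
Definition dTV (R : realType) (Q kappa n : nat) (t : nat) : R :=
  \big[Num.max/0]_(s0 : config Q kappa n)
    \big[Num.max/0]_(A : {set config Q kappa n})
      `| \sum_(s in A) law_at R t s0 s - \sum_(s in A) gibbs R s |.

(* [is_mixing_time Q kappa n eps T] : T is the minimum of the set of times t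
   with dTV t <= eps; in particular this set is nonempty. *)
Definition is_mixing_time (R : realType) (Q kappa n : nat) (eps : R) (T : nat) : Prop :=
  dTV R Q kappa n T <= eps /\
  forall t : nat, dTV R Q kappa n t <= eps -> (T <= t)%N.

(* Main.v *)
Require Import Defs.
From mathcomp Require Import all_boot all_order all_algebra.
From mathcomp Require Import all_classical all_reals all_analysis.
From mathcomp Require Import all_fingroup.
From mathcomp Require Import ring lra zify.

Set Implicit Arguments.
Unset Strict Implicit.
Unset Printing Implicit Defensive.

Import Order.TTheory GRing.Theory Num.Theory.
Local Open Scope ring_scope.


                                                                              
                                                                              
                                                                           
                                                                              
                                                                               
                                                                         
                       
                                                                     
                                                                        
                                                                         
                                                                             
                                                                            
                                    

                                                                         
                                                                            
                                                                              
                                                            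
                        

                                                    

(** Split every station into [kappa] slots and let a permutation [s] send each of the N =
    [kappa * Q] labels to a slot; n labels are particles, the other m = N - n are vacancies. The
    Gibbs weight is a product of falling factorials, so the stations of the particles under a
    uniform permutation have law [gibbs] ([count_cfg]). Updating coordinate i means moving particle
    i to a uniform slot not held by another particle ([refresh_cfg]). The dynamics thus lifts to a
    self-adjoint operator P = [refresh] on functions of permutations, the mean over i of the
    conditional expectations given the positions of the particles other than i.

    Upper bound. Let A_k be the sum, over sets S of k particles, of the conditional expectations
    [avg S] given the positions of S. With theta = m/(m+1), the energies of f satisfy <P A_(k+1) f,
    f> <= (1 - (k+1) theta/n) <A_(k+1) f, f> + ((n-k) theta/n) <A_k f, f> ([refresh_level_le]). P
    commutes with A_k and is positive, so the inequality survives inserting P^t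
    ([commuting_form_iter_ge0], [level_energy_step]). If <avg S f, f> <= c^|S| w for all S,
    induction on time gives |P^t f|^2 <= (1 + (c-1) r^(2t))^n w with r = 1 - theta/n
    ([level_energy_le], [iter_refresh_sqr_le]), the shape of the bound for n independent
    coordinates. For the indicator of a starting configuration c = Q e works, because k^j <= e^j
    k(k-1)...(k-j+1) ([avg_indicator_le]). Cauchy-Schwarz then bounds [dTV] ([dTV_le]), and the
    bound is small at time n log n / 2 + O(n).

    Lower bound. For weights w_i of sum zero, the sum of w_i 1(sigma_i = v0) is an eigenfunction
    with eigenvalue r, and its variance stays at most n ([refresh_test], [law_at_test_sqr]). From an
    evenly spread start, with w_i the centred indicator that i starts at v0, its initial value is of
    order n. Its mean r^t times this value therefore still exceeds sqrt n by a large factor at time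
    n log n / 2 - O(n), and Chebyshev's inequality separates the law from equilibrium ([dTV_ge]).

    The condition rho <= 1/2 gives m >= n, so replacing theta by 1 shifts the times by O(n) only. *)

(** * The unnormalised scalar product on functions over a finite type *)

Section DotProduct.
Variables (R : realType) (T : finType).
Implicit Types f g h : T -> R.

Definition dot f g : R := \sum_x f x * g x.

Lemma dotC f g : dot f g = dot g f.
Proof. by apply: eq_bigr => x _; rewrite mulrC. Qed.

Lemma eq_dot f f' g g' : f =1 f' -> g =1 g' -> dot f g = dot f' g'.
Proof. by move=> ff' gg'; apply: eq_bigr => x _; rewrite ff' gg'. Qed.

Lemma dotDl f g h : dot (fun x => f x + g x) h = dot f h + dot g h.
Proof. by rewrite -big_split; apply: eq_bigr => x _; rewrite mulrDl. Qed.

Lemma dotZl a f h : dot (fun x => a * f x) h = a * dot f h.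
Proof. by rewrite mulr_sumr; apply: eq_bigr => x _; rewrite mulrA. Qed.

Lemma dotBl f g h : dot (fun x => f x - g x) h = dot f h - dot g h.
Proof. by rewrite -sumrB; apply: eq_bigr => x _; rewrite mulrBl. Qed.

Lemma dot_suml (I : Type) (r : seq I) (P : pred I) (F : I -> T -> R) h :
  dot (fun x => \sum_(i <- r | P i) F i x) h = \sum_(i <- r | P i) dot (F i) h.
Proof.
rewrite /dot exchange_big; apply: eq_bigr => x _.
by rewrite mulr_suml.
Qed.

Lemma dotDr f g h : dot h (fun x => f x + g x) = dot h f + dot h g.
Proof. by rewrite dotC dotDl !(dotC h). Qed.

Lemma dotZr a f h : dot h (fun x => a * f x) = a * dot h f.
Proof. by rewrite dotC dotZl (dotC h). Qed.

Lemma dotBr f g h : dot h (fun x => f x - g x) = dot h f - dot h g.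
Proof. by rewrite dotC dotBl !(dotC h). Qed.

Lemma dot_sumr (I : Type) (r : seq I) (P : pred I) (F : I -> T -> R) h :
  dot h (fun x => \sum_(i <- r | P i) F i x) = \sum_(i <- r | P i) dot h (F i).
Proof. by rewrite dotC dot_suml; apply: eq_bigr => i _; rewrite dotC. Qed.

Lemma dot_ge0 f : 0 <= dot f f.
Proof. by apply: sumr_ge0 => x _; rewrite -expr2 sqr_ge0. Qed.

Lemma psd_cauchy_schwarz (a b c : R) :
  (forall u v : R, 0 <= u ^+ 2 * a + 2 * (u * v) * b + v ^+ 2 * c) ->
  b ^+ 2 <= a * c.
Proof.
move=> psd.
have a0 : 0 <= a by have := psd 1 0; lra.
have c0 : 0 <= c by have := psd 0 1; lra.
have [a_eq0|a_neq0] := eqVneq a 0.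
  (* At this point the form equals -b^2 (c + 2), which forces b = 0. *)
  have := psd (- (c + 1)) b; rewrite a_eq0 mulr0 mul0r.
  nra.
have {}a0 : 0 < a by rewrite lt_def a_neq0.
have := psd (- b) a.
have -> : (- b) ^+ 2 * a + 2 * (- b * a) * b + a ^+ 2 * c =
  a * (a * c - b ^+ 2) by ring.
by rewrite pmulr_rge0 // subr_ge0.
Qed.

Lemma dot_sqr_le f g : dot f g ^+ 2 <= dot f f * dot g g.
Proof.
apply: psd_cauchy_schwarz => u v.
have := dot_ge0 (fun x => u * f x + v * g x).
rewrite dotDl !dotDr !dotZl !dotZr (dotC g f).
suff <- : u * (u * dot f f) + u * (v * dot f g) +
  (v * (u * dot f g) + v * (v * dot g g)) =
  u ^+ 2 * dot f f + 2 * (u * v) * dot f g + v ^+ 2 * dot g g by [].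
by ring.
Qed.

End DotProduct.

(** * Positive forms that commute with a positive operator *)

Section CommutingForm.
Variables (R : realType) (T : finType).
Variables (P : (T -> R) -> T -> R) (B : (T -> R) -> (T -> R) -> R) (C : R).
Hypothesis BC : forall f g, B f g = B g f.
Hypothesis B_lin : forall (a b : R) f g h,
  B (fun x => a * f x + b * g x) h = a * B f h + b * B g h.
Hypothesis B_ge0 : forall f, 0 <= B f f.
Hypothesis B_le : forall f, B f f <= C * dot f f.
Hypothesis BP : forall f g, B (P f) g = B f (P g).
Hypothesis P_contr : forall f,
  dot (fun x => f x - P f x) (fun x => f x - P f x) <= dot f f.

Let J f := fun x => f x - P f x.

Lemma form_subl f g : B (J f) g = B f g - B (P f) g.
Proof.
have := B_lin 1 (-1) f (P f) g.
rewrite mul1r mulN1r => <-; congr B.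
by apply/funext => x; rewrite /J mul1r mulN1r.
Qed.

Lemma form_sqr_le f g : B f g ^+ 2 <= B f f * B g g.
Proof.
apply: psd_cauchy_schwarz => u v.
have := B_ge0 (fun x => u * f x + v * g x).
rewrite B_lin (BC f) (BC g) !B_lin (BC g f).
suff <- : u * (u * B f f + v * B f g) + v * (u * B f g + v * B g g) =
  u ^+ 2 * B f f + 2 * (u * v) * B f g + v ^+ 2 * B g g by [].
by ring.
Qed.

                                                                   
                                                 
(** A substitute for the square root of P. Suppose [B (P f) f] is negative and put J = 1 - P. The
    numbers a_j = B(J^j f, J^j f) are log-convex by Cauchy-Schwarz, and the assumption makes a_1 >
    a_0, so they grow geometrically. But J is a contraction and B is bounded, so they stay
    bounded. *)
Lemma commuting_form_ge0 f : 0 <= B (P f) f.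
Proof.
rewrite leNgt; apply/negP => neg.
have JB g h : B (J g) h = B g (J h).
  by rewrite form_subl BP (BC g (J h)) form_subl (BC h g) (BC (P h) g).
pose a j := B (iter j J f) (iter j J f).
have logconvex j : a j.+1 ^+ 2 <= a j * a j.+2.
  by rewrite {1}/a /= -JB mulrC form_sqr_le.
have z_gt : a 0%N < B (J f) f by rewrite form_subl /a /=; lra.
have y0 : 0 <= a 0%N by exact: B_ge0.
have zle : B (J f) f ^+ 2 <= a 1%N * a 0%N by exact: form_sqr_le.
have a0_gt : 0 < a 0%N.
  rewrite lt_def y0 andbT; apply/eqP => a00.
  by move: zle z_gt; rewrite a00 mulr0; nra.
pose q := a 1%N / a 0%N.
have a1E : a 1%N = q * a 0%N by rewrite /q divfK // gt_eqF.
have q1 : 1 < q.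
  rewrite /q ltr_pdivlMr // mul1r -(ltr_pM2r a0_gt).
  apply: lt_le_trans zle; rewrite expr2 ltr_pM //.
have step j : 0 < a j /\ q * a j <= a j.+1.
  elim: j => [|j [aj IH]]; first by rewrite a1E.
  have aj1 : 0 < a j.+1 by apply: lt_le_trans IH; rewrite mulr_gt0 //; lra.
  split => //.
  have := logconvex j => lc.
  rewrite -(ler_pM2l aj); apply: le_trans lc.
  by rewrite mulrA [a j * q]mulrC expr2 ler_pM2r.
have growth j : q ^+ j * a 0%N <= a j.
  elim: j => [|j IH]; first by rewrite mul1r.
  apply: le_trans (step j).2; rewrite exprS -mulrA ler_pM2l //; lra.
have bound j : a j <= `|C| * dot f f.
  have jle : dot (iter j J f) (iter j J f) <= dot f f.
    by elim: j => [|j IH] //=; apply: le_trans IH; exact: P_contr.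
  apply: le_trans (B_le _) _.
  apply: le_trans (_ : `|C| * dot (iter j J f) (iter j J f) <= _).
    by rewrite ler_wpM2r ?dot_ge0 // ler_norm.
  by rewrite ler_wpM2l.
have bern j : 1 + j%:R * (q - 1) <= q ^+ j.
  elim: j => [|j IH]; first by rewrite mul0r addr0.
  rewrite exprS.
  apply: le_trans (_ : q * (1 + j%:R * (q - 1)) <= _); last first.
    by rewrite ler_pM2l //; lra.
  rewrite -natr1 -subr_ge0.
  set x := j%:R.
  have -> : q * (1 + x * (q - 1)) - (1 + (x + 1) * (q - 1)) =
    x * (q - 1) ^+ 2 by ring.
  by rewrite mulr_ge0 ?sqr_ge0.
pose M := `|C| * dot f f / a 0%N / (q - 1).
have q10 : 0 < q - 1 by lra.
have [n Mn] : exists n : nat, M < n%:R.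
  by exists (Num.truncn M).+1; rewrite truncnS_gt.
have := le_trans (growth n) (bound n).
rewrite -ler_pdivlMr //.
have := bern n.
move: Mn; rewrite /M ltr_pdivrMr //.
lra.
Qed.

(** Half of the iterates move to the other argument; one P is left over when t is odd. *)
Lemma commuting_form_iter_ge0 t f : 0 <= B (iter t P f) f.
Proof.
have move_half j k : B (iter (j + k) P f) f = B (iter k P f) (iter j P f).
  elim: j k => [//|j IH] k.
  by rewrite addSnnS IH /= BP.
rewrite -(odd_double_half t) -addnn addnA.
case: (odd t); last by rewrite add0n move_half B_ge0.
by rewrite add1n addSnnS move_half /= commuting_form_ge0.
Qed.

End CommutingForm.

                                            

(** * Averages over the permutations that fix a set of labels *)

Section FixingAverage.
Variables (R : realType) (D : finType).
Implicit Types (S : {set D}) (F G : {perm D} -> R) (g s : {perm D}).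

Definition fixing S : {set {perm D}} :=
  [set g : {perm D} | [forall x in S, g x == x]].

Lemma fixingP S g : reflect {in S, forall x, g x = x} (g \in fixing S).
Proof.
by rewrite inE; apply: (iffP forall_inP) => gS x xS; apply/eqP; exact: gS.
Qed.

Lemma fixing1 S : 1%g \in fixing S.
Proof. by apply/fixingP => x _; rewrite perm1. Qed.

Lemma fixingM S g h : g \in fixing S -> h \in fixing S -> (g * h)%g \in fixing S.
Proof.
by move=> /fixingP gS /fixingP hS; apply/fixingP => x xS; rewrite permM gS ?hS.
Qed.

Lemma fixingV S g : g \in fixing S -> g^-1%g \in fixing S.
Proof.
by move=> /fixingP gS; apply/fixingP => x xS; rewrite -{1}(gS x xS) permK.
Qed.

Lemma fixingMl S g h : g \in fixing S -> ((g * h)%g \in fixing S) = (h \in fixing S).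
Proof.
move=> gS; apply/idP/idP => [ghS|]; last exact: fixingM.
by rewrite -(mulKg g h) fixingM // fixingV.
Qed.

Lemma fixingMr S g h : g \in fixing S -> ((h * g)%g \in fixing S) = (h \in fixing S).
Proof.
move=> gS; apply/idP/idP => [ghS|hS]; last exact: fixingM.
by rewrite -(mulgK g h) fixingM // fixingV.
Qed.

Lemma fixingS S S' g : S \subset S' -> g \in fixing S' -> g \in fixing S.
Proof.
by move=> /fintype.subsetP SS' /fixingP gS; apply/fixingP => x /SS'; exact: gS.
Qed.

Lemma fixing_tperm S x y : x \notin S -> y \notin S -> tperm x y \in fixing S.
Proof.
move=> xS yS; apply/fixingP => z zS; rewrite tpermD //.
  by apply: contraNneq xS => ->.
by apply: contraNneq yS => ->.
Qed.

Lemma card_fixing_gt0 S : (0 < #|fixing S|)%N.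
Proof. by apply/card_gt0P; exists 1%g; exact: fixing1. Qed.

Lemma card_fixing_neq0 S : #|fixing S|%:R != 0 :> R.
Proof. by rewrite pnatr_eq0 -lt0n card_fixing_gt0. Qed.

(** Since (g * s) x = s (g x), left multiplication by g permutes the labels that are not fixed and
    leaves those in S in place. Hence this is the conditional expectation of F given the positions
    of the labels in S, an orthogonal projection for [dot]. *)
Definition avg S F s : R :=
  #|fixing S|%:R^-1 * \sum_(g in fixing S) F (g * s)%g.

Lemma eq_avg S F G : F =1 G -> avg S F =1 avg S G.
Proof. by move=> FG s; congr (_ * _); apply: eq_bigr => g _; rewrite FG. Qed.

Lemma avg_fixing S F g s : g \in fixing S -> avg S F (g * s)%g = avg S F s.
Proof.
move=> gS; congr (_ * _).
rewrite [RHS](reindex_inj (mulIg g)) /=.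
by apply: eq_big => h; rewrite ?fixingMr // mulgA.
Qed.

Lemma avg_shift S F g s :
  g \in fixing S -> avg S (fun s => F (g * s)%g) s = avg S F s.
Proof.
move=> gS; congr (_ * _).
rewrite [RHS](reindex_inj (mulgI g)) /=.
by apply: eq_big => h; rewrite ?fixingMl // mulgA.
Qed.

Lemma avg_id S F :
  (forall g s, g \in fixing S -> F (g * s)%g = F s) -> avg S F =1 F.
Proof.
move=> Finv s; rewrite /avg (eq_bigr (fun=> F s)) => [|g gS]; last exact: Finv.
by rewrite sumr_const -[F s *+ _]mulr_natl mulKf ?card_fixing_neq0.
Qed.

Lemma avg_avgr S S' F : S \subset S' -> avg S' (avg S F) =1 avg S F.
Proof.
move=> SS'; apply: avg_id => g s gS.
by apply: avg_fixing; exact: fixingS gS.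
Qed.

Lemma avg_sum (I : Type) (r : seq I) (p : pred I) S (F : I -> {perm D} -> R) s :
  avg S (fun s => \sum_(i <- r | p i) F i s) s =
  \sum_(i <- r | p i) avg S (F i) s.
Proof. by rewrite /avg exchange_big /= mulr_sumr. Qed.

(** Tower property: [fixing S'] lies inside [fixing S], so the inner shift is absorbed by the outer
    average. *)
Lemma avg_avgl S S' F : S \subset S' -> avg S (avg S' F) =1 avg S F.
Proof.
move=> SS' s; rewrite {1}/avg.
transitivity (#|fixing S|%:R^-1 * \sum_(g in fixing S)
    (#|fixing S'|%:R^-1 * \sum_(h in fixing S') F (h * (g * s))%g)).
  by [].
rewrite -mulr_sumr exchange_big /= mulrCA.
have E h : h \in fixing S' ->
    \sum_(g in fixing S) F (h * (g * s))%g = \sum_(g in fixing S) F (g * s)%g.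
  move=> hS'; rewrite [RHS](reindex_inj (mulgI h)) /=.
  apply: eq_big => [g|g _]; last by rewrite mulgA.
  by rewrite fixingMl //; exact: fixingS hS'.
rewrite (eq_bigr _ E) sumr_const -[_ *+ #|_|]mulr_natl.
by rewrite [X in _ * X]mulrCA mulKf ?card_fixing_neq0.
Qed.

Lemma dot_shift g F G :
  dot (fun s => F (g * s)%g) G = dot F (fun s => G (g^-1 * s)%g).
Proof.
rewrite /dot [RHS](reindex_inj (mulgI g)) /=.
by apply: eq_bigr => s _; rewrite mulKg.
Qed.

Lemma dot_avg S F G : dot (avg S F) G = dot F (avg S G).
Proof.
rewrite dotZl dotZr; congr (_ * _); rewrite dot_suml dot_sumr.
rewrite (eq_bigr _ (fun g _ => dot_shift g F G)) [LHS](reindex_inj invg_inj) /=.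
apply: eq_big => [g|g _]; last by rewrite invgK.
by apply/idP/idP => /fixingV //; rewrite invgK.
Qed.

Lemma dot_avg_avg S F : dot (avg S F) (avg S F) = dot (avg S F) F.
Proof. by rewrite -dot_avg; apply: eq_dot => // s; exact: avg_avgr. Qed.

Lemma dot_avg_ge0 S F : 0 <= dot (avg S F) F.
Proof. by rewrite -dot_avg_avg dot_ge0. Qed.

Lemma dot_avg_le S F : dot (avg S F) F <= dot F F.
Proof.
have := dot_ge0 (fun s => F s - avg S F s).
rewrite dotBl !dotBr dot_avg_avg (dotC F (avg S F)); lra.
Qed.

(** Conjugation by the transposition of i and j carries [fixing (j |: Q)] onto [fixing (i |: Q)]. *)
Lemma avg_tperm (Q : {set D}) (i j : D) F s : i \notin Q -> j \notin Q ->
  avg (i |: Q) F (tperm i j * s)%g =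
  avg (j |: Q) (fun s => F (tperm i j * s)%g) s.
Proof.
move=> iQ jQ; rewrite /avg.
have mem (g : {perm D}) : ((tperm i j * (g * tperm i j))%g \in fixing (i |: Q)) =
    (g \in fixing (j |: Q)).
  have aux (a b : D) (h : {perm D}) : a \notin Q -> b \notin Q -> h \in fixing (b |: Q) ->
      (tperm a b * (h * tperm a b))%g \in fixing (a |: Q).
    move=> aQ bQ /fixingP hb; apply/fixingP => x; rewrite !permM !inE.
    case/orP => [/eqP->|xQ]; first by rewrite tpermL hb ?tpermR // setU11.
    have tx : tperm a b x = x by move: x xQ; apply/fixingP; exact: fixing_tperm.
    by rewrite tx hb ?tx // inE xQ orbT.
  apply/idP/idP => [gi|]; last exact: aux.
  have := aux j i _ jQ iQ gi; rewrite (tpermC j i).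
  by rewrite !mulgA tperm2 mul1g -mulgA tperm2 mulg1.
have inj : injective (fun g : {perm D} => (tperm i j * (g * tperm i j))%g).
  by move=> g h /mulgI /mulIg.
have cards : #|fixing (j |: Q)| = #|fixing (i |: Q)|.
  rewrite -sum1_card -[RHS]sum1_card [RHS](reindex_inj inj) /=.
  by apply: eq_bigl => g; rewrite mem.
congr (_ * _); first by rewrite cards.
rewrite (reindex_inj inj) /=; apply: eq_big => [g|g _]; first exact: mem.
by congr F; rewrite -!mulgA (mulgA (tperm i j) (tperm i j)) tperm2 mul1g.
Qed.

(** Given the positions of S without i, label i is uniform over the positions of the labels outside
    S without i. In group terms, [fixing (S :\ i)] splits into cosets of [fixing S] according to the
    image of i. *)
Lemma avg_setD1_sum S (i : D) F s : i \in S ->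
    (forall g s, g \in fixing S -> F (g * s)%g = F s) ->
  #|~: (S :\ i)|%:R * avg (S :\ i) F s =
  \sum_(j in ~: (S :\ i)) F (tperm i j * s)%g.
Proof.
move=> iS Finv.
have iSi : i \notin S :\ i by rewrite !inE eqxx.
have split G : \sum_(g in fixing (S :\ i)) G g =
    \sum_(j in ~: (S :\ i)) \sum_(h in fixing S) G (h * tperm i j)%g :> R.
  rewrite (partition_big (fun g : {perm D} => g i) (mem (~: (S :\ i)))) /=.
    apply: eq_bigr => j; rewrite inE => jS.
    rewrite (reindex_inj (mulIg (tperm i j))) /=; apply: eq_bigl => h.
    rewrite permM fixingMr ?fixing_tperm //.
    apply/andP/idP => [[/fixingP hS /eqP hi]|hS].
      have {}hi : h i = i.
        by apply: (@perm_inj _ (tperm i j)); rewrite hi tpermL.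
      apply/fixingP => x xS; have [->//|xi] := eqVneq x i.
      by rewrite hS // !inE xi.
    split; first by apply: fixingS hS; exact: subD1set.
    by move/fixingP: hS => -> //; rewrite tpermL.
  move=> g gS; rewrite inE; apply: contraT; rewrite negbK => giS.
  move/fixingP: (gS) => /(_ _ giS) /perm_inj giE.
  by move: giS; rewrite giE !inE eqxx.
have card : #|fixing (S :\ i)|%:R = #|~: (S :\ i)|%:R * #|fixing S|%:R :> R.
  have := split (fun=> 1); rewrite !sumr_const => ->.
  by rewrite -[_ *+ #|~: _|]mulr_natl.
rewrite /avg split card invfM mulrA mulrA mulfV ?mul1r; last first.
  rewrite pnatr_eq0 -lt0n; apply/card_gt0P; exists i; rewrite inE //.
rewrite mulr_sumr; apply: eq_bigr => j _.
rewrite (eq_bigr (fun=> F (tperm i j * s)%g)) => [|h hS]; last first.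
  by rewrite -mulgA (Finv h).
by rewrite sumr_const -[X in _ * X]mulr_natl mulKf ?card_fixing_neq0.
Qed.

End FixingAverage.

                                                      

(** * The labelled exclusion operator and its level energies *)

Section ExclusionOperator.
Variables (R : realType) (D : finType) (L : {set D}).
Implicit Types (S Q : {set D}) (f g h : {perm D} -> R) (s : {perm D}).

                                                                              
                                                                             
                                                                
(** One step of the lifted chain: a uniform particle is resampled given the positions of all the
    others. *)
Definition refresh f s : R := #|L|%:R^-1 * \sum_(i in L) avg (L :\ i) f s.

Definition avg_level k f s : R :=
  \sum_(S : {set D} | (S \subset L) && (#|S| == k)) avg S f s.

Lemma sum_level_succ (k : nat) (G : {set D} -> D -> R) :
  \sum_(S : {set D} | (S \subset L) && (#|S| == k.+1)) \sum_(i in S) G S i =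
  \sum_(Q : {set D} | (Q \subset L) && (#|Q| == k))
    \sum_(i in L :\: Q) G (i |: Q) i.
Proof.
rewrite (pair_big_dep _ (fun S i => i \in S)) /=.
rewrite (pair_big_dep _ (fun Q i => i \in L :\: Q)) /=.
rewrite (reindex_onto (fun p : {set D} * D => (p.2 |: p.1, p.2))
  (fun p : {set D} * D => (p.1 :\ p.2, p.2))) /=; last first.
  by move=> [S i] /= /andP[_ iS]; rewrite finset.setD1K.
apply: eq_bigl => -[Q i] /=; rewrite xpair_eqE eqxx andbT finset.in_setD finset.setU11 andbT.
have [iQ|iQ] := boolP (i \in Q).
  rewrite andbF; apply/negP => /andP[_ /eqP QE].
  by move: iQ; rewrite -QE !inE eqxx.
rewrite finset.setU1K // eqxx andbT cardsU1 iQ eqSS finset.subUset finset.sub1set /=.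
by case: (i \in L); rewrite ?andbF ?andbT.
Qed.

Lemma eq_refresh f g : f =1 g -> refresh f =1 refresh g.
Proof.
by move=> fg s; congr (_ * _); apply: eq_bigr => i _; exact: eq_avg.
Qed.

Lemma dot_refreshE f g :
  dot (refresh f) g = #|L|%:R^-1 * \sum_(i in L) dot (avg (L :\ i) f) g.
Proof. by rewrite dotZl dot_suml. Qed.

Lemma dot_avg_levelE k f g : dot (avg_level k f) g =
  \sum_(S : {set D} | (S \subset L) && (#|S| == k)) dot (avg S f) g.
Proof. by rewrite dot_suml. Qed.

Lemma dot_refresh f g : dot (refresh f) g = dot f (refresh g).
Proof.
rewrite (dotC f) !dot_refreshE; congr (_ * _).
by apply: eq_bigr => i _; rewrite dot_avg dotC.
Qed.

Lemma dot_avg_level k f g : dot (avg_level k f) g = dot f (avg_level k g).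
Proof.
rewrite (dotC f) !dot_avg_levelE.
by apply: eq_bigr => i _; rewrite dot_avg dotC.
Qed.

(** A mean of orthogonal projections satisfies P^2 <= P, since <p f, P f> <= (|p f|^2 + |P f|^2)/2
    for each of them. *)
Lemma refresh_sqr_le f : dot (refresh f) (refresh f) <= dot (refresh f) f.
Proof.
have [L0|Lgt0] := posnP #|L|.
  by rewrite !dot_refreshE L0 invr0 !mul0r.
have step : dot (refresh f) (refresh f) <=
    #|L|%:R^-1 *
    \sum_(i in L) (dot (avg (L :\ i) f) f / 2 + dot (refresh f) (refresh f) / 2).
  rewrite {1}dot_refreshE ler_wpM2l ?invr_ge0 //.
  apply: ler_sum => i _.
  have := dot_ge0 (fun s => avg (L :\ i) f s - refresh f s).
  rewrite dotBl !dotBr dot_avg_avg (dotC (refresh f) (avg _ f)).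
  lra.
move: step; rewrite big_split /= -!mulr_suml mulrDr mulrA -dot_refreshE.
have sumc c : \sum_(i in L) c = #|L|%:R * c by rewrite sumr_const mulr_natl.
rewrite sumc -(mulrA #|L|%:R) mulKf ?pnatr_eq0 -?lt0n //; lra.
Qed.

Lemma dot_refresh_ge0 f : 0 <= dot (refresh f) f.
Proof. by apply: le_trans (refresh_sqr_le f); exact: dot_ge0. Qed.

Lemma dot_refresh_le f : dot (refresh f) f <= dot f f.
Proof.
have [L0|Lgt0] := posnP #|L|.
  by rewrite dot_refreshE L0 invr0 mul0r dot_ge0.
rewrite dot_refreshE ler_pdivrMl ?ltr0n // mulr_natl -sumr_const.
by apply: ler_sum => i _; exact: dot_avg_le.
Qed.

Lemma refresh_contraction f :
  dot (fun s => f s - refresh f s) (fun s => f s - refresh f s) <= dot f f.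
Proof.
have := refresh_sqr_le f; have := dot_refresh_ge0 f.
rewrite dotBl !dotBr (dotC f (refresh f)); lra.
Qed.

(** Particle i may go to any slot not held by [L :\ i]. These are the slots not held by [S :\ i],
    which together give a multiple of [avg (S :\ i) f], minus the slots held by the particles of
    [L :\: S], which give the swap terms. *)
Lemma refresh_avg_in S f i s : S \subset L -> i \in S ->
  #|~: L|.+1%:R * avg (L :\ i) (avg S f) s =
  (#|D|%:R - #|S|%:R + 1) * avg (S :\ i) f s
  - \sum_(j in L :\: S) avg S f (tperm i j * s)%g.
Proof.
move=> SL iS; have iL : i \in L by move/fintype.subsetP: SL; apply.
                                                                            
                                                                    
have invS (h s' : {perm D}) : h \in fixing S -> avg S f (h * s')%g = avg S f s'.
  exact: avg_fixing.
have invL (h s' : {perm D}) : h \in fixing L -> avg S f (h * s')%g = avg S f s'.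
  by move=> hL; apply: invS; exact: fixingS hL.
have cardC (T : {set D}) : i \in T -> #|~: (T :\ i)| = #|~: T|.+1.
  by move=> iT; rewrite finset.setCD finset.setUC cardsU1 inE iT.
have EL := avg_setD1_sum s iL invL.
have ES := avg_setD1_sum s iS invS.
rewrite cardC // in EL; rewrite cardC // in ES.
have cS : #|~: S|.+1%:R = #|D|%:R - #|S|%:R + 1 :> R.
  by rewrite -natr1 -(cardsC S) natrD; lra.
rewrite EL -cS.
have -> : avg (S :\ i) f s = avg (S :\ i) (avg S f) s.
  by rewrite avg_avgl // finset.subD1set.
rewrite ES.
have LS : ~: (L :\ i) \subset ~: (S :\ i) by rewrite finset.setCS finset.setSD.
rewrite [X in _ = X - _](big_setID (~: (L :\ i))) /=.
rewrite (finset.setIidPr LS) -addrA [X in _ = _ + X](_ : _ = 0) ?addr0 //.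
apply/eqP; rewrite subr_eq0; apply/eqP; apply: eq_bigl => j.
rewrite !inE negbK; case: eqVneq => [->|] /=; last by rewrite andbC.
by rewrite iS.
Qed.

(** The correlation of [avg (i |: Q) f], read with j in the role of i, against g. It is symmetric
    under exchanging both (i, f) and (j, g), which is what makes P commute with the level
    operators. *)
Let swap_dot Q i j f g :=
  dot (fun s => avg (i |: Q) f (tperm i j * s)%g) g.

Lemma swap_dotC Q i j f g : i \notin Q -> j \notin Q ->
  swap_dot Q i j f g = swap_dot Q j i g f.
Proof.
move=> iQ jQ; rewrite /swap_dot.
rewrite (eq_dot (fun s => avg_tperm f s iQ jQ) (frefl g)).
rewrite dot_avg dot_shift dotC; apply: eq_dot => // s.
by rewrite tpermV tpermC.
Qed.

Lemma swap_dot_avg Q i j f g : i \notin Q -> j \notin Q ->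
  swap_dot Q i j f g =
  dot (fun s => avg (i |: Q) f (tperm i j * s)%g) (avg (j |: Q) g).
Proof.
move=> iQ jQ; rewrite /swap_dot.
rewrite -dot_avg; apply: eq_dot => // s.
by rewrite (eq_avg _ (fun s => avg_tperm f s iQ jQ)) avg_avgr // avg_tperm.
Qed.

                                                                            
                                                                            
                       
(** Transporting every [avg (i |: Q) f] to one reference label i0 and adding up gives a function c
    whose squared norm is the double sum. Its projection onto the functions of the positions of Q is
    |M| times [avg Q f], and a projection does not increase the norm. *)
Lemma swap_dot_sum_ge Q f : Q \subset L ->
  #|L :\: Q|%:R ^+ 2 * dot (avg Q f) f <=
  \sum_(i in L :\: Q) \sum_(j in L :\: Q) swap_dot Q i j f f.
Proof.
move=> QL; set M := L :\: Q.
have [->|[i0 i0M]] := set_0Vmem M.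
  by rewrite cards0 expr0n mul0r big_set0.
have MQ i : i \in M -> i \notin Q by rewrite inE => /andP[].
pose c s := \sum_(i in M) avg (i |: Q) f (tperm i0 i * s)%g.
have cc : dot c c = \sum_(i in M) \sum_(j in M) swap_dot Q i j f f.
  rewrite /c dot_suml; apply: eq_bigr => i iM.
  rewrite dot_sumr; apply: eq_bigr => j jM.
  have [i0Q [iQ jQ]] := (MQ _ i0M, (MQ _ iM, MQ _ jM)).
  rewrite swap_dot_avg // [LHS]dotC (dot_shift (tperm i0 j) (avg (j |: Q) f)).
  rewrite [LHS]dotC tpermV.
  apply: eq_dot => // s.
  rewrite -(@avg_fixing R D (i |: Q) f
      (tperm i0 i * (tperm i0 j * tperm i j))%g (tperm i j * s)%g).
    by rewrite -!mulgA (mulgA (tperm i j) (tperm i j)) tperm2 mul1g.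
  apply/fixingP => x; rewrite !permM !inE => /orP[/eqP ->|xQ].
    rewrite tpermR; have [->|ji0] := eqVneq j i0; first by rewrite tperm1 perm1 tpermR.
    by rewrite tpermL tpermR.
  have xx a : a \notin Q -> x != a by move=> aQ; apply: contraNneq aQ => <-.
  by rewrite !tpermD // eq_sym xx.
have avgc : avg Q c =1 (fun s => #|M|%:R * avg Q f s).
  move=> s; rewrite avg_sum (eq_bigr (fun=> avg Q f s)) => [|i iM].
    by rewrite sumr_const mulr_natl.
  rewrite (avg_shift (avg (i |: Q) f)) ?fixing_tperm ?MQ //.
  by rewrite avg_avgl // finset.subsetU1.
rewrite -cc; apply: le_trans (dot_avg_le Q c).
rewrite -(dot_avg_avg Q c) (eq_dot avgc avgc).
rewrite (dotZl #|M|%:R (avg Q f)) (dotZr #|M|%:R (avg Q f)) dot_avg_avg.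
by rewrite mulrA expr2.
Qed.

Let level_swap k f g :=
  \sum_(Q : {set D} | (Q \subset L) && (#|Q| == k))
    \sum_(i in L :\: Q) \sum_(j in L :\: (i |: Q)) swap_dot Q i j f g.

Lemma level_swapC k f g : level_swap k f g = level_swap k g f.
Proof.
apply: eq_bigr => Q _.
have E (G : D -> D -> R) :
    \sum_(i in L :\: Q) \sum_(j in L :\: (i |: Q)) G i j =
    \sum_(i in L :\: Q) \sum_(j in L :\: Q | i != j) G i j.
  apply: eq_bigr => i _; apply: eq_bigl => j.
  by rewrite !inE negb_or eq_sym; case: (i != j); rewrite /= ?andbT ?andbF.
rewrite !E.
rewrite (exchange_big_dep (mem (L :\: Q))) /= => [|i j _ /andP[]//].
apply: eq_bigr => j jM.
apply: eq_big => [i|i]; first by rewrite jM /= eq_sym.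
rewrite jM /= => /andP[iM _]; apply: swap_dotC.
  by move: iM; rewrite inE => /andP[].
by move: jM; rewrite inE => /andP[].
Qed.

(** Refreshing a particle outside S leaves [avg S f] unchanged, which gives the first term. For a
    particle inside S, [refresh_avg_in] gives the term one level down and the swap terms. *)
Lemma dot_refresh_level k f g : (k < #|L|)%N ->
  #|L|%:R * #|~: L|.+1%:R * dot (refresh (avg_level k.+1 f)) g =
  #|~: L|.+1%:R * (#|L|%:R - k.+1%:R) * dot (avg_level k.+1 f) g
  + (#|D|%:R - k%:R) * (#|L|%:R - k%:R) * dot (avg_level k f) g
  - level_swap k f g.
Proof.
move=> kL; have L0 : #|L|%:R != 0 :> R by rewrite pnatr_eq0 -lt0n (leq_ltn_trans _ kL).
rewrite dot_refreshE mulrAC mulrA mulfV // mul1r.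
rewrite (eq_bigr (fun i => \sum_(S : {set D} | (S \subset L) && (#|S| == k.+1))
    dot (avg (L :\ i) (avg S f)) g)) => [|i _]; last first.
  by rewrite -dot_suml; apply: eq_dot => // s; rewrite avg_sum.
rewrite exchange_big /= mulr_suml.
have E1 S : (S \subset L) && (#|S| == k.+1) ->
  (\sum_(i in L) dot (avg (L :\ i) (avg S f)) g) * #|~: L|.+1%:R =
  #|~: L|.+1%:R * (#|L|%:R - k.+1%:R) * dot (avg S f) g +
  (\sum_(i in S) (#|D|%:R - k%:R) * dot (avg (S :\ i) f) g -
   \sum_(i in S) \sum_(j in L :\: S) dot (fun s => avg S f (tperm i j * s)%g) g).
  move=> /andP[SL /eqP cS].
  rewrite mulrC (big_setID S) /= (finset.setIidPr SL) addrC mulrDr; congr (_ + _).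
    rewrite (eq_bigr (fun=> dot (avg S f) g)) => [|i]; last first.
      rewrite inE => /andP[iS iL]; apply: eq_dot => // s.
      by rewrite avg_avgr // finset.subsetD1 SL.
    rewrite sumr_const -mulrA; congr (_ * _); rewrite -[LHS]mulr_natl; congr (_ * _).
    by rewrite cardsD (finset.setIidPr SL) natrB ?cS // -cS subset_leq_card.
  rewrite mulr_sumr -sumrB; apply: eq_bigr => i iS.
  rewrite -dotZl (eq_dot (fun s => refresh_avg_in f s SL iS) (frefl g)).
  rewrite dotBl dotZl dot_suml cS; congr (_ * _ - _).
  by rewrite -natr1; lra.
rewrite (eq_bigr _ E1) big_split /= -mulr_sumr -dot_avg_levelE -addrA.
congr (_ + _).
rewrite sumrB; congr (_ - _).
  rewrite sum_level_succ dot_avg_levelE mulr_sumr; apply: eq_bigr => Q.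
  move=> /andP[QL /eqP cQ].
  rewrite (eq_bigr (fun=> (#|D|%:R - k%:R) * dot (avg Q f) g)) => [|i].
    rewrite sumr_const -[LHS]mulr_natl cardsD (finset.setIidPr QL) natrB ?cQ.
      by rewrite mulrA [_ * (#|D|%:R - _)]mulrC.
    by rewrite -cQ subset_leq_card.
  by rewrite inE => /andP[iQ _]; rewrite finset.setU1K.
exact: sum_level_succ.
Qed.

(** Every term on the right of [dot_refresh_level] is symmetric in f and g. As P and the level
    operators are each self-adjoint, this says that they commute. *)
Lemma refresh_levelC k f g : (k < #|L|)%N ->
  dot (refresh (avg_level k.+1 f)) g = dot f (refresh (avg_level k.+1 g)).
Proof.
move=> kL; rewrite (dotC f).
have nz : #|L|%:R * #|~: L|.+1%:R != 0 :> R.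
  by rewrite mulf_neq0 ?pnatr_eq0 // -lt0n (leq_ltn_trans _ kL).
apply: (mulfI nz); rewrite !dot_refresh_level // level_swapC.
by rewrite !(dot_avg_level _ f) !(dotC f).
Qed.

(** [swap_dot_sum_ge] summed over Q; its diagonal terms j = i are [dot (avg (i |: Q) f) f] and add
    up to k+1 times the energy of level k+1. *)
Lemma level_swap_ge k f :
  (#|L|%:R - k%:R) ^+ 2 * dot (avg_level k f) f
    - k.+1%:R * dot (avg_level k.+1 f) f <= level_swap k f f.
Proof.
have -> : k.+1%:R * dot (avg_level k.+1 f) f =
  \sum_(S : {set D} | (S \subset L) && (#|S| == k.+1))
    \sum_(i in S) dot (avg S f) f.
  rewrite dot_avg_levelE mulr_sumr; apply: eq_bigr => S /andP[_ /eqP <-].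
  by rewrite sumr_const mulr_natl.
rewrite sum_level_succ dot_avg_levelE mulr_sumr lerBlDr -big_split /=.
apply: ler_sum => Q /andP[QL /eqP cQ].
have -> : #|L|%:R - k%:R = #|L :\: Q|%:R :> R.
  by rewrite cardsD (finset.setIidPr QL) -cQ natrB // subset_leq_card.
apply: le_trans (swap_dot_sum_ge f QL) _.
rewrite -big_split /=; apply: ler_sum => i iM.
rewrite (bigD1 i) //= addrC lerD //.
  rewrite le_eqVlt; apply/orP; left; apply/eqP; apply: eq_bigl => j.
  by rewrite !inE negb_or; case: (j == i); rewrite /= ?andbF ?andbT.
rewrite le_eqVlt; apply/orP; left; apply/eqP; apply: eq_dot => // s.
by rewrite tperm1 mul1g.
Qed.

(** The probability m/(m+1) that a refreshed particle leaves its slot; it measures how far the chain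
    lags behind independent resampling, where it would be 1. *)
Definition lag : R := #|~: L|%:R / #|~: L|.+1%:R.

(** With n particles and m vacancies, inserting the swap bound leaves (m+1)(n-k-1) + (k+1) = n(m+1)
    - (k+1)m at level k+1 and (n-k)(n+m-k) - (n-k)^2 = (n-k)m at level k. *)
Lemma refresh_level_le k f : (k < #|L|)%N ->
  dot (refresh (avg_level k.+1 f)) f <=
  (1 - k.+1%:R * lag / #|L|%:R) * dot (avg_level k.+1 f) f
  + (#|L|%:R - k%:R) * lag / #|L|%:R * dot (avg_level k f) f.
Proof.
move=> kL.
have L0 : 0 < #|L|%:R :> R by rewrite ltr0n (leq_ltn_trans _ kL).
have m0 : 0 < #|~: L|.+1%:R :> R by rewrite ltr0n.
have pos : 0 < #|L|%:R * #|~: L|.+1%:R :> R by rewrite mulr_gt0.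
rewrite -(ler_pM2l pos) dot_refresh_level //.
have := level_swap_ge k f.
set a1 := dot (avg_level k.+1 f) f; set a0 := dot (avg_level k f) f; set b := level_swap _ _ _.
have DE : #|D|%:R = #|L|%:R + #|~: L|%:R :> R by rewrite -natrD cardsC.
rewrite DE /lag -[in #|~: L|.+1%:R]natr1 => ge.
have mE : #|~: L|.+1%:R = #|~: L|%:R + 1 :> R by rewrite -natr1.
rewrite mE in m0.
set m := #|~: L|%:R in m0 *; set n := #|L|%:R in L0 ge *.
have -> : n * (m + 1) * ((1 - k.+1%:R * (m / (m + 1)) / n) * a1 +
    (n - k%:R) * (m / (m + 1)) / n * a0) =
  (n * (m + 1) - k.+1%:R * m) * a1 + (n - k%:R) * m * a0.
  by field; rewrite !gt_eqF.
by move: ge; rewrite -!natr1; nra.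
Qed.

End ExclusionOperator.

(** * Decay of the level energies in time *)

Lemma tangent_le_expr (R : realDomainType) (x y : R) k : 0 <= x -> 0 <= y ->
  x ^+ k.+1 + k.+1%:R * x ^+ k * (y - x) <= y ^+ k.+1.
Proof.
move=> x0 y0; elim: k => [|k IH]; first by rewrite !expr1 expr0; lra.
rewrite (exprS y); apply: le_trans (ler_wpM2l y0 IH).
rewrite -subr_ge0 -!natr1 !exprS.
set k' := k%:R; set u := x ^+ k.
have -> : y * (x * u + (k' + 1) * u * (y - x)) -
    (x * (x * u) + (k' + 1 + 1) * (x * u) * (y - x)) =
  (k' + 1) * u * (y - x) ^+ 2 by ring.
by rewrite mulr_ge0 ?sqr_ge0 // mulr_ge0 ?exprn_ge0 // addr_ge0.
Qed.

                                    

Section EnergyDecay.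
Variables (R : realType) (D : finType) (L : {set D}).
Hypothesis L_gt0 : (0 < #|L|)%N.
Implicit Types (f g h : {perm D} -> R).

Local Notation P := (@refresh R D L).
Local Notation A := (@avg_level R D L).
Local Notation lag := (lag R L).

Let L_gt0R : 0 < #|L|%:R :> R. Proof. by rewrite ltr0n. Qed.

Lemma refresh_level0 f s : P (A 0 f) s = A 0 f s.
Proof.
have E : A 0 f =1 avg finset.set0 f.
  move=> s'; rewrite /avg_level.
  rewrite (big_pred1 finset.set0) // => S.
  by rewrite /= cards_eq0; case: eqP => [->|]; rewrite ?finset.sub0set ?andbF.
rewrite E (eq_refresh L E) /refresh.
rewrite (eq_bigr (fun=> avg finset.set0 f s)) => [|i _]; last first.
  by rewrite avg_avgr // finset.sub0set.
by rewrite sumr_const -[X in _ * X]mulr_natl mulKf // gt_eqF.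
Qed.

Lemma refresh_level_selfadjoint k f g : (k <= #|L|)%N ->
  dot (P (A k f)) g = dot f (P (A k g)).
Proof.
case: k => [_|k kL]; last exact: refresh_levelC.
rewrite (eq_dot (refresh_level0 f) (frefl g)) dot_avg_level.
by apply: eq_dot => // s; rewrite refresh_level0.
Qed.

Lemma dot_level_refresh k f g : (k <= #|L|)%N ->
  dot (A k (P f)) g = dot (A k f) (P g).
Proof.
move=> kL.
by rewrite dot_avg_level dot_refresh -refresh_level_selfadjoint // dot_refresh.
Qed.

Let decay k : R := 1 - k.+1%:R * lag / #|L|%:R.
Let gain k : R := (#|L|%:R - k%:R) * lag / #|L|%:R.

(** The difference of the two sides of [refresh_level_le] is a positive bounded form B that commutes
    with P, so [commuting_form_iter_ge0] allows P^t in one argument. *)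
Lemma level_energy_step k t f : (k < #|L|)%N ->
  dot (A k.+1 (iter t.+1 P f)) f <=
  decay k * dot (A k.+1 (iter t P f)) f +
  gain k * dot (A k (iter t P f)) f.
Proof.
move=> kL; have kL' := ltnW kL.
rewrite /= dot_level_refresh // -dot_refresh -subr_ge0.
pose B u v := decay k * dot (A k.+1 u) v + gain k * dot (A k u) v
  - dot (P (A k.+1 u)) v.
rewrite -[X in 0 <= X]/(B (iter t P f) f).
(* The form B only has to be bounded: each [avg S] is a contraction, so counting the sets S
   suffices. *)
pose c : R := #|[pred S : {set D} | (S \subset L) && (#|S| == k.+1)]|%:R.
pose c' : R := #|[pred S : {set D} | (S \subset L) && (#|S| == k)]|%:R.
apply: (@commuting_form_iter_ge0 R _ P B (`|decay k| * c + `|gain k| * c' + c)).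
- move=> u v; rewrite /B refresh_level_selfadjoint // (dotC u).
  by rewrite !(dot_avg_level _ _ u) !(dotC u).
- move=> a b u v w; rewrite /B !dot_refresh !dot_avg_level.
  by rewrite !dotDl !dotZl; ring.
- by move=> u; rewrite /B subr_ge0 refresh_level_le.
- have lev (j : nat) u : 0 <= dot (A j u) u <=
      #|[pred S : {set D} | (S \subset L) && (#|S| == j)]|%:R * dot u u.
    rewrite dot_avg_levelE mulr_natl -sumr_const sumr_ge0 /=; last first.
      by move=> S _; exact: dot_avg_ge0.
    by apply: ler_sum => S _; exact: dot_avg_le.
  move=> u; rewrite /B (mulrDl _ c) (mulrDl _ (`|gain k| * c')) lerD //.
    apply: lerD.
      have /andP[l0 l1] := lev k.+1 u.
      by apply: le_trans (ler_wpM2r l0 (ler_norm _)) _; rewrite -mulrA ler_wpM2l.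
    have /andP[l0 l1] := lev k u.
    by apply: le_trans (ler_wpM2r l0 (ler_norm _)) _; rewrite -mulrA ler_wpM2l.
  rewrite dot_refresh dot_avg_levelE -sumrN mulr_natl -sumr_const.
  apply: ler_sum => S _.
  have := dot_ge0 (fun s => avg S u s + P u s).
  rewrite dotDl !dotDr dot_avg_avg (dotC (P u) (avg S u)).
  have := dot_avg_le S u; have := refresh_sqr_le L u; have := dot_refresh_le L u.
  lra.
- move=> u v; rewrite /B !dot_level_refresh // !dot_refresh.
  by rewrite dot_level_refresh.
- exact: refresh_contraction.
Qed.

Lemma lag_ge0 : 0 <= lag.
Proof. by rewrite divr_ge0. Qed.

Lemma lag_le1 : lag <= 1.
Proof. by rewrite ler_pdivrMr ?ltr0n // mul1r ler_nat. Qed.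

Lemma rate_ge0 : 0 <= 1 - lag / #|L|%:R.
Proof.
rewrite subr_ge0 ler_pdivrMr // mul1r (le_trans lag_le1) //.
by rewrite ler1n.
Qed.

(** The comparison value is what n independent coordinates would give. With z = 1 + (c-1) r^t, one
    step of the recursion turns z^(k+1) into its tangent approximation at the next value z' = z -
    (lag/n)(z-1), and convexity puts this below z'^(k+1). *)
Lemma level_energy_le (c w : R) k t f : 1 <= c -> 0 <= w ->
    (forall S : {set D}, S \subset L -> dot (avg S f) f <= c ^+ #|S| * w) ->
    (k <= #|L|)%N ->
  dot (A k (iter t P f)) f <=
  'C(#|L|, k)%:R * (1 + (c - 1) * (1 - lag / #|L|%:R) ^+ t) ^+ k * w.
Proof.
move=> c1 w0 cw.
elim: t k => [|t IH] [|k] kL.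
- rewrite dot_avg_levelE (big_pred1 finset.set0) => [|S].
    rewrite bin0 !expr0 !mul1r; have := cw finset.set0 (finset.sub0set _).
    by rewrite cards0 mul1r.
  by rewrite /= cards_eq0; case: eqP => [->|]; rewrite ?finset.sub0set ?andbF.
- rewrite expr0 mulr1 addrC subrK.
  rewrite -cards_draws -mulrA mulr_natl -sumr_const dot_avg_levelE big_mkcond.
  rewrite [leRHS]big_mkcond; apply: ler_sum => S _; rewrite inE.
  by case: ifP => // /andP[SL /eqP cS]; rewrite -cS cw.
- rewrite /= dot_level_refresh // -dot_refresh.
  rewrite (eq_dot (refresh_level0 _) (frefl f)).
  by apply: le_trans (IH 0%N kL) _; rewrite !expr0.
- apply: le_trans (level_energy_step t f kL) _.
  set z := 1 + (c - 1) * (1 - lag / #|L|%:R) ^+ t.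
  have z0 : 1 <= z.
    by rewrite lerDl mulr_ge0 ?subr_ge0 // exprn_ge0 // rate_ge0.
  have -> : 1 + (c - 1) * (1 - lag / #|L|%:R) ^+ t.+1 =
      z - lag / #|L|%:R * (z - 1).
    by rewrite /z exprS; ring.
  set z' := z - _.
  have z'0 : 0 <= z'.
    have -> : z' = 1 + (1 - lag / #|L|%:R) * (z - 1) by rewrite /z'; ring.
    by rewrite addr_ge0 // mulr_ge0 ?rate_ge0 // subr_ge0.
  have decay0 : 0 <= decay k.
    rewrite subr_ge0 ler_pdivrMr // mul1r.
    rewrite (le_trans (ler_piMr _ lag_le1)) ?ler_nat //.
  have gain0 : 0 <= gain k.
    by rewrite divr_ge0 // mulr_ge0 ?lag_ge0 // subr_ge0 ler_nat ltnW.
  apply: le_trans (lerD (ler_wpM2l decay0 (IH _ kL))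
    (ler_wpM2l gain0 (IH _ (ltnW kL)))) _.
  have binE : (#|L|%:R - k%:R) * 'C(#|L|, k)%:R = k.+1%:R * 'C(#|L|, k.+1)%:R :> R.
    by rewrite -natrB ?(ltnW kL) // -!natrM mul_bin_left.
  rewrite /decay /gain -/z.
  have -> : (1 - k.+1%:R * lag / #|L|%:R) * ('C(#|L|, k.+1)%:R * z ^+ k.+1 * w) +
      (#|L|%:R - k%:R) * lag / #|L|%:R * ('C(#|L|, k)%:R * z ^+ k * w) =
    (1 - k.+1%:R * lag / #|L|%:R) * ('C(#|L|, k.+1)%:R * z ^+ k.+1 * w) +
      lag / #|L|%:R * (((#|L|%:R - k%:R) * 'C(#|L|, k)%:R) * z ^+ k * w) by ring.
  rewrite binE.
  have -> : (1 - k.+1%:R * lag / #|L|%:R) * ('C(#|L|, k.+1)%:R * z ^+ k.+1 * w) +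
      lag / #|L|%:R * (k.+1%:R * 'C(#|L|, k.+1)%:R * z ^+ k * w) =
    'C(#|L|, k.+1)%:R * (z ^+ k.+1 + k.+1%:R * z ^+ k * (z' - z)) * w.
    by rewrite /z' exprS; ring.
  rewrite ler_wpM2r // ler_wpM2l // tangent_le_expr //; lra.
Qed.

(** The top level consists of [avg L] alone, which fixes f, so the squared norm is the energy of
    level n at time 2t. *)
Lemma iter_refresh_sqr_le (c w : R) t f : 1 <= c -> 0 <= w ->
    (forall S : {set D}, S \subset L -> dot (avg S f) f <= c ^+ #|S| * w) ->
    avg L f =1 f ->
  dot (iter t P f) (iter t P f) <=
  (1 + (c - 1) * (1 - lag / #|L|%:R) ^+ t.*2) ^+ #|L| * w.
Proof.
move=> c1 w0 cw fL.
have half j k : dot (iter (j + k) P f) f =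
    dot (iter k P f) (iter j P f).
  elim: j k => [//|j IH] k.
  by rewrite addSnnS IH /= dot_refresh.
rewrite -half addnn.
have -> : dot (iter t.*2 P f) f =
    dot (A #|L| (iter t.*2 P f)) f.
  rewrite dot_avg_levelE (big_pred1 L) => [|S].
    by rewrite dot_avg; apply: eq_dot => // s; rewrite fL.
  rewrite /=; apply/andP/eqP => [[SL /eqP cS]|->]; last by [].
  by apply/eqP; rewrite eqEcard SL cS /=.
apply: le_trans (level_energy_le _ c1 w0 cw (leqnn _)) _.
by rewrite binn mul1r.
Qed.

End EnergyDecay.

                                     

(** * Counting placements of labels with prescribed stations *)

Section StationCounting.
Variables (R : realType) (D : finType) (Q kappa : nat) (st : D -> 'I_Q).
Hypothesis card_st : forall v, #|[set z | st z == v]| = kappa.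
Implicit Types (S T : {set D}) (c : D -> 'I_Q) (s : {perm D}).

Definition matches c T s : bool := [forall i in T, st (s i) == c i].

Definition tally c T (v : 'I_Q) : nat := #|[set i in T | c i == v]|.

(** The number of ways to put the labels of T into distinct slots, each at its station under c. *)
Definition weight c T : nat := \prod_v kappa ^_ (tally c T v).

Lemma matchesU1 c T i s :
  matches c (i |: T) s = (st (s i) == c i) && matches c T s.
Proof.
apply/forall_inP/andP => [M|[ci /forall_inP M] j].
  split; first by apply: M; rewrite finset.setU11.
  by apply/forall_inP => j jT; apply: M; rewrite inE jT orbT.
by rewrite inE => /orP[|jT]; [rewrite inE => /eqP ->|exact: M].
Qed.

Lemma tallyU1 c T i v : i \notin T ->
  tally c (i |: T) v = ((c i == v) + tally c T v)%N.
Proof.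
move=> iT; rewrite /tally; have [civ|civ] := eqVneq (c i) v.
  have -> : [set j in i |: T | c j == v] = i |: [set j in T | c j == v].
    apply/setP => j; rewrite !inE; have [->|//] := eqVneq j i.
    by rewrite civ eqxx.
  by rewrite cardsU1 inE (negPf iT).
apply: eq_card => j; rewrite !inE; have [->|] := eqVneq j i; last by [].
by rewrite (negPf civ) !andbF.
Qed.

Lemma weightU1 c T i : i \notin T ->
  weight c (i |: T) = (weight c T * (kappa - tally c T (c i)))%N.
Proof.
move=> iT; rewrite /weight (bigD1 (c i)) //= [in RHS](bigD1 (c i)) //=.
rewrite tallyU1 // eqxx add1n ffactnSr mulnAC; congr (_ * _ * _)%N.
by apply: eq_bigr => v vi; rewrite tallyU1 // eq_sym (negPf vi).
Qed.

Lemma card_perm_st s v : #|[set j | st (s j) == v]| = kappa.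
Proof.
rewrite -(card_st v) -(card_imset _ (@perm_inj _ s)); apply: eq_card => z.
rewrite !inE; apply/imsetP/idP => [[j + ->]|zv]; first by rewrite inE.
by exists (s^-1 z)%g; rewrite ?inE permKV.
Qed.

Lemma card_free_st c T s v : matches c T s ->
  #|[set j in ~: T | st (s j) == v]| = (kappa - tally c T v)%N.
Proof.
move=> /forall_inP M.
rewrite -(card_perm_st s v) -(cardsID T [set j | st (s j) == v]) /tally.
have -> : [set j | st (s j) == v] :&: T = [set i in T | c i == v].
  apply/setP => j; rewrite !inE andbC.
  by have [jT|//] := boolP (j \in T); rewrite (eqP (M j jT)).
by rewrite addKn; apply: eq_card => j; rewrite !inE.
Qed.

                                                                         
                                                           
(** By exchangeability label i may be replaced by any label j outside T. Summing over j counts the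
    slots of station [c i] not held by T, of which there are [kappa - tally c T (c i)] whenever T
    matches. *)
Lemma avg_matchesU1 S T c i s : S \subset T -> i \notin T ->
  #|~: T|%:R * avg S (fun s => (matches c (i |: T) s)%:R : R) s =
  (kappa - tally c T (c i))%:R * avg S (fun s => (matches c T s)%:R) s.
Proof.
move=> ST iT.
have E j : j \in ~: T ->
    avg S (fun s => (matches c (i |: T) s)%:R : R) s =
    avg S (fun s => (st (s j) == c i)%:R * (matches c T s)%:R) s.
  rewrite inE => jT.
  have tT : tperm i j \in fixing T by exact: fixing_tperm.
  rewrite -(avg_shift _ s (fixingS ST tT)); apply: eq_avg => s'.
  rewrite matchesU1 permM tpermL -natrM mulnb; congr (_ && _)%:R.
  apply: eq_forallb => x; case: (boolP (x \in T)) => //= xT.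
  by rewrite permM; move/fixingP: tT => ->.
rewrite mulr_natl -sumr_const (eq_bigr _ E) -avg_sum.
rewrite /avg [RHS]mulrCA; congr (_ * _); rewrite mulr_sumr.
apply: eq_bigr => g _; rewrite -mulr_suml.
case: (boolP (matches c T (g * s)%g)) => [M|_]; last by rewrite !mulr0.
rewrite !mulr1 -(card_free_st _ M) -sum1_card natr_sum big_mkcond /=.
rewrite [RHS]big_mkcond; apply: eq_bigr => j _; rewrite !inE.
by case: (j \in T) => //=; case: (_ == _).
Qed.

(** The conditional probability that T matches given S is a ratio of placement counts; it is
    cross-multiplied because [weight c S] may vanish. *)
Lemma avg_matches S T c s : S \subset T ->
  avg S (fun s => (matches c T s)%:R : R) s
    * ((weight c S)%:R * (#|D| ^_ #|T|)%:R) =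
  (matches c S s)%:R * ((weight c T)%:R * (#|D| ^_ #|S|)%:R).
Proof.
move=> ST; have [k kE] : exists k, k = #|T :\: S| by exists #|T :\: S|.
elim: k T ST kE => [|k IH] T ST kE.
  have SE : T = S.
    by apply/eqP; rewrite finset.eqEsubset ST andbT -finset.setD_eq0 -cards_eq0 -kE.
  rewrite SE avg_id // => g s' /fixingP gS; congr (_%:R).
  congr nat_of_bool; apply: eq_forallb => x.
  by case: (boolP (x \in S)) => //= xS; rewrite permM gS.
have [i] : exists i, i \in T :\: S by apply/card_gt0P; rewrite -kE.
rewrite inE => /andP[iS iT]; set T' := T :\ i.
have TE : T = i |: T' by rewrite finset.setD1K.
have iT' : i \notin T' by rewrite !inE eqxx.
have ST' : S \subset T' by rewrite finset.subsetD1 ST.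
have {}IH : avg S (fun s => (matches c T' s)%:R : R) s
    * ((weight c S)%:R * (#|D| ^_ #|T'|)%:R) =
  (matches c S s)%:R * ((weight c T')%:R * (#|D| ^_ #|S|)%:R).
  apply: IH => //; apply: succn_inj.
  rewrite kE TE finset.setDUl.
  have -> : [set i] :\: S = [set i].
    by apply/setP => x; rewrite !inE; case: eqVneq => [->|]; rewrite ?iS ?andbF.
  by rewrite cardsU1 finset.in_setD (negPf iT') andbF.
rewrite TE weightU1 // cardsU1 iT' add1n ffactnSr.
have -> : (#|D| - #|T'|)%N = #|~: T'| by rewrite -(cardsC T') addKn.
rewrite !natrM.
have := avg_matchesU1 c s ST' iT'.
set a := avg _ _ _; set a' := avg _ _ _ in IH *.
set C := #|~: T'|%:R; set K := (kappa - _)%:R => E.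
transitivity ((C * a) * ((weight c S)%:R * (#|D| ^_ #|T'|)%:R)); first by ring.
rewrite E -mulrA IH; ring.
Qed.

End StationCounting.

Lemma ffact_le_expn (j k : nat) : (k ^_ j <= k ^ j)%N.
Proof.
rewrite ffact_prod -[X in (_ <= _ ^ X)%N]card_ord -prod_nat_const.
by apply: leq_prod => i _; exact: leq_subr.
Qed.

(** Passing from k to k+1 costs a factor (1 + 1/k)^j, at most e because j <= k. This is the source
    of the constant c = Q e of the upper bound. *)
Lemma ffact_ge (R : realType) (j k : nat) : (j <= k)%N ->
  k%:R ^+ j <= expR 1 ^+ j * (k ^_ j)%:R :> R.
Proof.
have e1 : 1 <= expR 1 :> R by rewrite (le_trans _ (expR_ge1Dx 1)) // lerDl.
elim: k j => [|k IH] [|j] jk //; first by rewrite !expr0 mul1r.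
  by rewrite !expr0 mul1r.
rewrite ffactSS natrM mulrCA exprS ler_wpM2l //.
rewrite [X in _ <= X * _]exprS -mulrA.
have [k0|k0] := posnP k.
  by move: jk; rewrite k0 ltnS leqn0 => /eqP ->; rewrite !expr0 mul1r mulr1.
apply: le_trans (ler_wpM2l (expR_ge0 1) (IH _ jk)).
have -> : k.+1%:R = (1 + k%:R^-1) * k%:R :> R.
  by rewrite mulrDl mulVf ?mul1r ?pnatr_eq0 -?lt0n // -natr1 addrC.
rewrite exprMn ler_wpM2r ?exprn_ge0 //.
apply: le_trans (_ : expR k%:R^-1 ^+ j <= _).
  by rewrite lerXn2r ?nnegrE ?expR_ge0 ?addr_ge0 // expR_ge1Dx.
rewrite -expRM_natl ler_expR ler_pdivrMr ?ltr0n // mul1r ler_nat.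
exact: jk.
Qed.

Lemma eq_tally (D : finType) (Q : nat) (c c' : D -> 'I_Q) (T : {set D}) :
  {in T, c =1 c'} -> tally c T =1 tally c' T.
Proof.
move=> cc' v; apply: eq_card => z; rewrite !inE.
by case: (boolP (z \in T)) => //= zT; rewrite cc'.
Qed.

Lemma eq_weight (D : finType) (Q kappa : nat) (c c' : D -> 'I_Q) (T : {set D}) :
  {in T, c =1 c'} -> weight kappa c T = weight kappa c' T.
Proof. by move=> cc'; apply: eq_bigr => v _; rewrite (eq_tally cc'). Qed.

(** * The Gibbs weight as a product of falling factorials *)

Section Gibbs.
Variables (R : realType) (Q kappa n : nat).

Definition config_weight (c : {ffun 'I_n -> 'I_Q}) : nat :=
  \prod_v kappa ^_ (occupancy c v).

Lemma occupancy_le (s : config Q kappa n) v : (occupancy (val s) v <= kappa)%N.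
Proof. by have /forallP := valP s; apply. Qed.

Lemma config_weight_gt0 (s : config Q kappa n) : (0 < config_weight (val s))%N.
Proof. by rewrite prodn_gt0 // => v; rewrite ffact_gt0 occupancy_le. Qed.

Lemma sum_occupancy (c : {ffun 'I_n -> 'I_Q}) : (\sum_v occupancy c v = n)%N.
Proof.
rewrite -[RHS]card_ord -sum1_card (partition_big c predT) //=.
by apply: eq_bigr => v _; rewrite sum1dep_card.
Qed.

Lemma expR_phi_sum k : (k <= kappa)%N ->
  expR (- \sum_(0 <= j < k.+1) phi R kappa j) = (kappa ^_ k)%:R / kappa.+1%:R ^+ k.
Proof.
elim: k => [_|k IH kk].
  by rewrite big_nat1 /phi subr0 subrr oppr0 expR0 ffactn0 expr0 divr1.
rewrite big_nat_recr //= opprD expRD IH ?(ltnW kk) // /phi opprB expRD.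
rewrite expRN !lnK ?posrE ?ltr0n //; last by rewrite subr_gt0 ltr_nat ltnS.
rewrite ffactnSr natrM exprSr invfM -natrB; last exact: leqW.
by rewrite subSS mulrACA.
Qed.

Lemma expR_energy (s : config Q kappa n) :
  expR (- energy R s) = (config_weight (val s))%:R / kappa.+1%:R ^+ n.
Proof.
rewrite /energy -sumrN expR_sum /config_weight natr_prod.
have -> : (kappa.+1%:R : R) ^+ n = \prod_v kappa.+1%:R ^+ occupancy (val s) v.
  by rewrite prodrXr sum_occupancy.
rewrite -prodfV -big_split /=.
by apply: eq_bigr => v _; rewrite expR_phi_sum // occupancy_le.
Qed.

Lemma gibbsE (s : config Q kappa n) : gibbs R s =
  (config_weight (val s))%:R /
    \sum_(r : config Q kappa n) (config_weight (val r))%:R.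
Proof.
have E : partition_function R Q kappa n =
    (\sum_(r : config Q kappa n) (config_weight (val r))%:R) / kappa.+1%:R ^+ n.
  by rewrite mulr_suml; apply: eq_bigr => r _; rewrite expR_energy.
by rewrite /gibbs E expR_energy invf_div mulrA divfK.
Qed.

Lemma config_weight_sum_gt0 (s : config Q kappa n) :
  0 < \sum_(r : config Q kappa n) (config_weight (val r))%:R :> R.
Proof.
rewrite (bigD1 s) // ltr_pwDl ?ltr0n ?config_weight_gt0 //.
exact: sumr_ge0.
Qed.

Lemma gibbs_gt0 (s : config Q kappa n) : 0 < gibbs R s.
Proof.
by rewrite gibbsE divr_gt0 ?ltr0n ?config_weight_gt0 // config_weight_sum_gt0.
Qed.

End Gibbs.

                                                        

(** * Lifting the congestion dynamics to permutations *)

Section Lift.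
Variables (R : realType) (D : finType) (Q kappa n : nat).
Variables (st : D -> 'I_Q) (lab : 'I_n -> D).
Hypothesis card_st : forall v, #|[set z | st z == v]| = kappa.
Hypothesis lab_inj : injective lab.
Hypothesis n_gt0 : (0 < n)%N.
Implicit Types (s : {perm D}) (c : {ffun 'I_n -> 'I_Q}).

Definition labels : {set D} := [set lab i | i : 'I_n].

Lemma mem_labels i : lab i \in labels.
Proof. by apply: imset_f. Qed.

Lemma card_labels : #|labels| = n.
Proof. by rewrite card_imset // card_ord. Qed.

Definition stations s : {ffun 'I_n -> 'I_Q} := [ffun i => st (s (lab i))].

Lemma stations_config s : [forall v, (occupancy (stations s) v <= kappa)%N].
Proof.
apply/forallP => v; rewrite -(card_st v) /occupancy.
rewrite -(card_imset _ (inj_comp (@perm_inj _ s) lab_inj)) subset_leq_card //.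
apply/fintype.subsetP => z /imsetP[i + ->]; rewrite !inE /stations.
by rewrite ffunE.
Qed.

Definition cfg s : config Q kappa n := exist _ (stations s) (stations_config s).

                                                 
(** Extends a configuration to all labels, as [matches] and [weight] require; the value [st z] on
    vacancies is arbitrary, since these functions are only read on sets of particles. *)
Definition label_station c (z : D) : 'I_Q :=
  if [pick i | lab i == z] is Some i then c i else st z.

Lemma label_stationE c i : label_station c (lab i) = c i.
Proof.
rewrite /label_station; case: pickP => [j /eqP/lab_inj -> //|/(_ i)].
by rewrite eqxx.
Qed.

Lemma matches_labels c s : matches st (label_station c) labels s = (stations s == c).
Proof.
apply/forall_inP/eqP => [M|<- _ /imsetP[i _ ->]]; last first.
  by rewrite label_stationE ffunE.
apply/ffunP => i; rewrite ffunE.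
by have /eqP := M _ (mem_labels i); rewrite label_stationE.
Qed.

Lemma tally_labels c v : tally (label_station c) labels v = occupancy c v.
Proof.
rewrite /tally /occupancy -[RHS](card_imset _ lab_inj); apply: eq_card => z.
rewrite !inE; apply/andP/imsetP => [[/imsetP[i _ ->]]|[i + ->]].
  by rewrite label_stationE => ci; exists i; rewrite ?inE.
by rewrite inE mem_labels label_stationE.
Qed.

Lemma weight_labels c : weight kappa (label_station c) labels = config_weight kappa c.
Proof. by apply: eq_bigr => v _; rewrite tally_labels. Qed.

Lemma card_cfg (c : config Q kappa n) :
  (\sum_s (cfg s == c)%:R : R) * (#|D| ^_ n)%:R =
  (config_weight kappa (val c))%:R * #|{perm D}|%:R.
Proof.
have := avg_matches R card_st (label_station (val c)) 1 (finset.sub0set labels).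
rewrite weight_labels cards0 ffactn0 mulr1.
have -> : matches st (label_station (val c)) finset.set0 1%g.
  by apply/forall_inP => z; rewrite inE.
have -> : weight kappa (label_station (val c)) finset.set0 = 1%N.
  rewrite /weight big1 // => v _; rewrite /tally.
  by rewrite (_ : [set i in _ | _] = finset.set0) ?cards0 //; apply/setP => z; rewrite !inE.
rewrite !mul1r card_labels /avg.
have fT : fixing (finset.set0 : {set D}) = [set: {perm D}].
  by apply/setP => g; rewrite [RHS]inE; apply/fixingP => z; rewrite inE.
rewrite fT finset.cardsT => <-.
have perm0 : #|{perm D}|%:R != 0 :> R.
  by rewrite pnatr_eq0 -lt0n; apply/card_gt0P; exists 1%g.
rewrite mulrAC [_^-1 * _]mulrC mulfVK //; congr (_ * _).
apply: eq_big => s; first by rewrite inE.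
by rewrite mulg1 matches_labels -val_eqE.
Qed.

Lemma leq_n_sites : (n <= #|D|)%N.
Proof. by rewrite -card_labels max_card. Qed.

Lemma sum_cfgE (F : config Q kappa n -> R) :
  \sum_s F (cfg s) = \sum_c (\sum_s (cfg s == c)%:R) * F c.
Proof.
rewrite (partition_big cfg predT) //=; apply: eq_bigr => c _.
rewrite big_mkcond /= mulr_suml; apply: eq_bigr => s _.
by case: eqP => [->|_]; rewrite ?mul1r ?mul0r.
Qed.

(** A uniform permutation projects to the Gibbs measure: [card_cfg] makes the fibre of c
    proportional to its weight, and summing over c identifies the normalising constant with
    N(N-1)...(N-n+1). *)
Lemma count_cfg (c : config Q kappa n) :
  \sum_s (cfg s == c)%:R = #|{perm D}|%:R * gibbs R c.
Proof.
have ff0 : (#|D| ^_ n)%:R != 0 :> R.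
  by rewrite pnatr_eq0 -lt0n ffact_gt0 leq_n_sites.
have W0 : \sum_(r : config Q kappa n) (config_weight kappa (val r))%:R != 0 :> R.
  by rewrite gt_eqF // (config_weight_sum_gt0 _ (cfg 1)).
have total : (#|D| ^_ n)%:R =
    \sum_(r : config Q kappa n) (config_weight kappa (val r))%:R :> R.
  have perm0 : #|{perm D}|%:R != 0 :> R.
    by rewrite pnatr_eq0 -lt0n; apply/card_gt0P; exists 1%g.
  apply: (mulfI perm0); rewrite [RHS]mulrC mulr_suml.
  rewrite -(eq_bigr _ (fun r _ => card_cfg r)) -mulr_suml; congr (_ * _).
  rewrite -sum1_card natr_sum (sum_cfgE (fun=> 1)).
  by apply: eq_bigr => r _; rewrite mulr1.
apply: (mulIf ff0); rewrite card_cfg gibbsE -mulrA total divfK //.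
by rewrite mulrC.
Qed.

Lemma sum_cfg (F : config Q kappa n -> R) :
  \sum_s F (cfg s) = #|{perm D}|%:R * \sum_c gibbs R c * F c.
Proof.
rewrite sum_cfgE mulr_sumr; apply: eq_bigr => c _.
by rewrite count_cfg mulrA.
Qed.

Lemma cfg_surj (c : config Q kappa n) : exists s, cfg s = c.
Proof.
have : 0 < \sum_s (cfg s == c)%:R :> R.
  rewrite count_cfg mulr_gt0 ?gibbs_gt0 ?ltr0n //.
  by apply/card_gt0P; exists 1%g.
rewrite -natr_sum ltr0n lt0n sum_nat_eq0 negb_forall => /existsP[s].
by rewrite /= eqb0 negbK => /eqP; exists s.
Qed.

Definition move c (i : 'I_n) (v : 'I_Q) : {ffun 'I_n -> 'I_Q} :=
  [ffun j => if j == i then v else c j].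

(** Lets sums over feasible updates run over all stations; an infeasible one gets the value 0. *)
Let extend (F : config Q kappa n -> R) c : R :=
  if insub c is Some r then F r else 0.

Lemma extend_val F (r : config Q kappa n) : extend F (val r) = F r.
Proof. by rewrite /extend valK. Qed.

Lemma sum_agree_off (F : config Q kappa n -> R) i (r : config Q kappa n) :
  \sum_(r' | agree_off i r r') F r' = \sum_v extend F (move (val r) i v).
Proof.
rewrite (partition_big (fun r' : config Q kappa n => val r' i) predT) //=; apply: eq_bigr => v _.
have E r' : agree_off i r r' && (val r' i == v) = (val r' == move (val r) i v).
  apply/andP/eqP => [[/forall_inP ag /eqP r'i]|r'E].
    apply/ffunP => j; rewrite ffunE; case: eqVneq => [->//|ji].
    by apply/eqP; exact: ag.
  split; last by rewrite r'E ffunE eqxx.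
  by apply/forall_inP => j ji; rewrite r'E ffunE (negPf ji).
rewrite /extend; case: insubP => [u _ uE|infeasible].
  by rewrite (big_pred1 u) // => r'; rewrite E -uE val_eqE.
rewrite big_pred0 // => r'; rewrite E; apply: contraNF infeasible => /eqP <-.
exact: (valP r').
Qed.

Let others i := labels :\ lab i.

Lemma stations_tperm s i e : e \in ~: others i ->
  stations (tperm (lab i) e * s)%g = move (stations s) i (st (s e)).
Proof.
move=> eo; apply/ffunP => j; rewrite !ffunE permM.
case: eqVneq => [->|ji]; first by rewrite tpermL.
rewrite tpermD // eq_sym ?(inj_eq lab_inj) //.
apply: contraTneq eo => <-.
by rewrite !inE negbK (inj_eq lab_inj) ji mem_labels.
Qed.

Let room s i v : R :=
  (kappa - tally (label_station (stations s)) (others i) v)%:R.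

Lemma avg_cfg (F : config Q kappa n -> R) i s :
  #|~: others i|%:R * avg (others i) (fun s => F (cfg s)) s =
  \sum_v room s i v * extend F (move (stations s) i v).
Proof.
have inv (g s' : {perm D}) : g \in fixing labels -> F (cfg (g * s')%g) = F (cfg s').
  move=> /fixingP gL; congr F; apply/val_inj/ffunP => j.
  by rewrite !ffunE permM gL // mem_labels.
rewrite (avg_setD1_sum s (mem_labels i) inv).
rewrite (partition_big (fun e => st (s e)) predT) //=.
apply: eq_bigr => v _.
rewrite (eq_bigr (fun=> extend F (move (stations s) i v))) => [|e].
  rewrite sumr_const -[LHS]mulr_natl; congr (_%:R * _).
  rewrite -(card_free_st card_st (s := s)).
    by apply: eq_card => e; rewrite [LHS]unfold_in /= !inE.
  have := matches_labels (stations s) s; rewrite eqxx => /forall_inP M.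
  by apply/forall_inP => z /finset.setD1P[_ zL]; exact: M.
move=> /andP[eo /eqP <-]; rewrite -stations_tperm //.
by rewrite -[stations _]/(val (cfg (tperm (lab i) e * s)%g)) extend_val.
Qed.

Lemma config_weight_move s i v :
  (config_weight kappa (move (stations s) i v))%:R =
  (weight kappa (label_station (stations s)) (others i))%:R * room s i v :> R.
Proof.
have io : lab i \notin others i by rewrite !inE eqxx.
have same : {in others i, label_station (move (stations s) i v) =1
    label_station (stations s)}.
  move=> z /finset.setD1P[ji /imsetP[j _ jE]]; move: ji; rewrite jE => ji.
  rewrite !label_stationE ffunE; case: eqVneq => // jiE.
  by rewrite jiE eqxx in ji.
rewrite -weight_labels -(finset.setD1K (mem_labels i)) -/(others i).
rewrite weightU1 // (eq_weight _ same) natrM; congr (_ * (_ - _)%:R).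
by rewrite (eq_tally same) label_stationE ffunE eqxx.
Qed.

(** Both sides choose station v with probability proportional to its slots free of the other
    particles: on the Gibbs side because the weight after the move factors as the weight of the
    others times [room] ([config_weight_move]), on the permutation side by [avg_cfg]. The
    normalisation is found by taking F = 1. *)
Lemma gibbs_cond_avg (F : config Q kappa n -> R) i s :
  \sum_r gibbs_cond R i (cfg s) r * F r =
  avg (others i) (fun s => F (cfg s)) s.
Proof.
have cond G : \sum_(r | agree_off i (cfg s) r) gibbs R r * G r =
    (weight kappa (label_station (stations s)) (others i))%:R /
      (\sum_(r : config Q kappa n) (config_weight kappa (val r))%:R) *
    (#|~: others i|%:R * avg (others i) (fun s => G (cfg s)) s).
  rewrite avg_cfg mulr_sumr sum_agree_off; apply: eq_bigr => v _.
  rewrite -[val (cfg s)]/(stations s).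
  rewrite mulrA [_ / _ * room _ _ _]mulrAC -config_weight_move /extend.
  by case: insubP => [u _ uE|_]; rewrite ?mulr0 // gibbsE uE.
have := cond (fun=> 1).
rewrite (eq_bigr (fun r => gibbs R r)) => [|r _]; last by rewrite mulr1.
rewrite avg_id // mulr1 => den.
have nz : \sum_(r | agree_off i (cfg s) r) gibbs R r != 0.
  rewrite gt_eqF // (bigD1 (cfg s)) /=; last by apply/forall_inP.
  by rewrite ltr_pwDl ?gibbs_gt0 // sumr_ge0 // => r _; rewrite ltW ?gibbs_gt0.
rewrite [LHS](_ : _ = (\sum_(r | agree_off i (cfg s) r) gibbs R r * F r) /
    \sum_(r | agree_off i (cfg s) r) gibbs R r).
  by rewrite cond mulrA -den mulrAC mulfV // mul1r.
rewrite mulr_suml [RHS]big_mkcond; apply: eq_bigr => r _.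
by rewrite /gibbs_cond; case: ifP => _; rewrite ?mul0r // mulrAC.
Qed.

Lemma refresh_labelsE (G : {perm D} -> R) s :
  refresh labels G s = n%:R^-1 * \sum_i avg (labels :\ lab i) G s.
Proof.
by rewrite /refresh card_labels big_imset //= => i j _ _; exact: lab_inj.
Qed.

Lemma refresh_const1 : refresh labels (fun=> 1) = fun _ : {perm D} => 1 :> R.
Proof.
apply/funext => s; rewrite refresh_labelsE (eq_bigr (fun=> 1)) => [|i _].
  by rewrite sumr_const card_ord mulVf // pnatr_eq0 -lt0n.
exact: avg_id.
Qed.

Lemma iter_refresh_const1 t :
  iter t (refresh labels) (fun=> 1) = fun _ : {perm D} => 1 :> R.
Proof. by elim: t => [//|t IH]; rewrite iterS IH refresh_const1. Qed.

Lemma refresh_cfg (F : config Q kappa n -> R) s :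
  refresh labels (fun s => F (cfg s)) s =
  \sum_r glauber R (cfg s) r * F r.
Proof.
rewrite refresh_labelsE (eq_bigr _ (fun i _ => esym (gibbs_cond_avg F i s))) exchange_big.
rewrite mulr_sumr; apply: eq_bigr => r _.
rewrite /glauber !mulr_suml mulr_sumr big_mkcond.
by apply: eq_big => // i _; rewrite mulrA.
Qed.

Lemma law_at_cfg t (F : config Q kappa n -> R) s :
  \sum_r law_at R t (cfg s) r * F r =
  iter t (refresh labels) (fun s => F (cfg s)) s.
Proof.
elim: t F => [|t IH] F.
  rewrite (bigD1 (cfg s)) //= eqxx mul1r big1 ?addr0 // => r /negPf ->.
  by rewrite mul0r.
rewrite iterSr /=.
have -> : refresh labels (fun s => F (cfg s)) =
    fun s => \sum_r glauber R (cfg s) r * F r.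
  by apply/funext => s'; exact: refresh_cfg.
rewrite -(IH (fun r => \sum_r' glauber R r r' * F r')).
rewrite (eq_bigr _ (fun r _ => mulr_suml _ _ _ _)) exchange_big /=.
apply: eq_bigr => r _; rewrite mulr_sumr.
by apply: eq_bigr => r' _; rewrite mulrA.
Qed.


Lemma card_sites : #|D| = (Q * kappa)%N.
Proof.
rewrite -sum1_card (partition_big st predT) //=.
rewrite (eq_bigr (fun=> kappa)) => [|v _]; first by rewrite sum_nat_const card_ord.
by rewrite -(card_st v) -sum1dep_card.
Qed.

(** N(N-1)...(N-|S|+1) <= (Q kappa)^|S|, and [ffact_ge] trades the powers of kappa at each station
    for falling factorials. *)
Lemma weight_ge (c : config Q kappa n) (S : {set D}) : S \subset labels ->
  (#|D| ^_ #|S|)%:R <=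
  (Q%:R * expR 1) ^+ #|S| * (weight kappa (label_station (val c)) S)%:R :> R.
Proof.
move=> SL; set l := label_station (val c).
have tally_le v : (tally l S v <= kappa)%N.
  apply: leq_trans (occupancy_le c v); rewrite -tally_labels subset_leq_card //.
  apply/fintype.subsetP => z; rewrite !inE => /andP[zS ->].
  by rewrite andbT; move/fintype.subsetP: SL; apply.
have tally_sum : (\sum_v tally l S v = #|S|)%N.
  rewrite -[RHS]sum1_card (partition_big l predT) //=.
  by apply: eq_bigr => v _; rewrite sum1dep_card.
apply: (@le_trans _ _ (Q%:R ^+ #|S| * kappa%:R ^+ #|S|)).
  by rewrite -exprMn -natrM -card_sites -natrX ler_nat ffact_le_expn.
rewrite exprMn -mulrA ler_wpM2l ?exprn_ge0 //.
rewrite -tally_sum -!prodrXr /weight natr_prod -big_split /=.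
apply: ler_prod => v _; rewrite exprn_ge0 //=.
exact: ffact_ge.
Qed.

(** Knowing the positions of S raises the probability of c by at most a factor Q e per known
    particle: by [avg_matches] this factor is N(N-1)...(N-|S|+1) over [weight], or zero. *)
Lemma avg_indicator_le (c : config Q kappa n) (S : {set D}) s : S \subset labels ->
  avg S (fun s => (cfg s == c)%:R) s <=
  (Q%:R * expR 1) ^+ #|S| * gibbs R c.
Proof.
move=> SL; set l := label_station (val c).
have ind : (fun s => (cfg s == c)%:R) = (fun s => (matches st l labels s)%:R) :> (_ -> R).
  by apply/funext => s'; rewrite matches_labels -val_eqE.
have W0 : 0 < (weight kappa l S)%:R :> R.
  have := weight_ge c SL; rewrite -/l ltr0n lt0n => le.
  apply: contraTneq le => ->; rewrite mulr0 -ltNge ltr0n ffact_gt0.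
  exact: max_card.
have N0 : 0 < (#|D| ^_ n)%:R :> R by rewrite ltr0n ffact_gt0 leq_n_sites.
have P0 : 0 < #|{perm D}|%:R :> R by rewrite ltr0n; apply/card_gt0P; exists 1%g.
have gE : gibbs R c = (weight kappa l labels)%:R / (#|D| ^_ n)%:R.
  apply: (mulIf (lt0r_neq0 N0)); rewrite divfK ?gt_eqF //.
  apply: (mulfI (lt0r_neq0 P0)).
  by rewrite mulrA -count_cfg card_cfg weight_labels mulrC.
have := avg_matches R card_st l s SL; rewrite card_labels => AM.
rewrite ind -(ler_pM2r (mulr_gt0 W0 N0)) AM.
rewrite gE mulrACA divfK ?gt_eqF //.
apply: le_trans (_ : (weight kappa l labels)%:R * (#|D| ^_ #|S|)%:R <= _).
  by rewrite ler_piMl ?mulr_ge0 //; case: (matches _ _ _ _).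
by rewrite mulrC ler_wpM2r // weight_ge.
Qed.

                                                                       
                                                                          
(** By reversibility [iter t P h / H], with h the indicator of the lifts of c0, is the law at time t
    lifted to permutations. Its l2 distance to the uniform law comes from [iter_refresh_sqr_le], and
    Cauchy-Schwarz against the indicator G of the event gives total variation. *)
Lemma dTV_le t : dTV R Q kappa n t <=
  Num.sqrt ((1 + (Q%:R * expR 1 - 1) * (1 - lag R labels / n%:R) ^+ t.*2) ^+ n - 1).
Proof.
apply: bigmax_le => [|c0 _]; first exact: sqrtr_ge0.
apply: bigmax_le => [|A _]; first exact: sqrtr_ge0.
pose F (r : config Q kappa n) : R := (r \in A)%:R.
pose G s := F (cfg s).
pose h s : R := (cfg s == c0)%:R.
pose H := \sum_s h s.
have -> : \sum_(s in A) law_at R t c0 s = \sum_s law_at R t c0 s * F s.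
  rewrite big_mkcond; apply: eq_bigr => s _; rewrite /F.
  by case: (s \in A); rewrite ?mulr1 ?mulr0.
have -> : \sum_(s in A) gibbs R s = \sum_s gibbs R s * F s.
  rewrite big_mkcond; apply: eq_bigr => s _; rewrite /F.
  by case: (s \in A); rewrite ?mulr1 ?mulr0.
set K := \sum_s _; set mu := \sum_s _.
pose P := @refresh R D labels.
have P0 : 0 < #|{perm D}|%:R :> R by rewrite ltr0n; apply/card_gt0P; exists 1%g.
have HE : H = #|{perm D}|%:R * gibbs R c0 by exact: count_cfg.
have H0 : 0 < H by rewrite HE mulr_gt0 ?gibbs_gt0.
have selfadj j f g : dot (iter j P f) g = dot f (iter j P g).
  by elim: j f => [//|j IH] f; rewrite iterSr IH dot_refresh.
have KE : H * K = dot (iter t P h) G.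
  rewrite selfadj /H mulr_suml; apply: eq_bigr => s _.
  rewrite /h; case: eqVneq => [E|_]; rewrite ?mul0r // !mul1r /K -E.
  exact: law_at_cfg.
have muE : #|{perm D}|%:R * mu = dot (fun=> 1) G.
  by rewrite /mu -sum_cfg; apply: eq_bigr => s _; rewrite mul1r.
have h1 : dot (iter t P h) (fun=> 1) = H.
  by rewrite selfadj iter_refresh_const1; apply: eq_bigr => s _; rewrite mulr1.
set X := (1 + _) ^+ n.
have hh : dot (iter t P h) (iter t P h) <= X * (H ^+ 2 / #|{perm D}|%:R).
  have c1 : 1 <= Q%:R * expR 1 :> R.
    rewrite mulr_ege1 // ?ler1n; last by rewrite (le_trans _ (expR_ge1Dx 1)) // lerDl.
    (* Q is positive because c0 assigns a station to particle 0. *)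
    by case: (Q) (val c0 (Ordinal n_gt0)) => // -[].
  have w0 : 0 <= H ^+ 2 / #|{perm D}|%:R by rewrite divr_ge0 ?sqr_ge0 // ltW.
  rewrite /X -{2}card_labels -{1}card_labels.
  apply: iter_refresh_sqr_le => //; first by rewrite card_labels.
    move=> S SL; apply: le_trans (_ : dot (fun=> (Q%:R * expR 1) ^+ #|S| * gibbs R c0) h <= _).
      by apply: ler_sum => s _; rewrite ler_wpM2r ?avg_indicator_le.
    have -> : gibbs R c0 = H / #|{perm D}|%:R by rewrite HE mulrC mulKf ?gt_eqF.
    rewrite /dot -mulr_sumr -/H -mulrA ler_wpM2l ?exprn_ge0 ?(le_trans _ c1) //.
    by rewrite expr2 mulrAC.
  apply: avg_id => g s /fixingP gL; rewrite /h; congr ((_ == _)%:R).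
  by apply/val_inj/ffunP => j; rewrite !ffunE permM gL // mem_labels.
pose u s := H^-1 * iter t P h s - #|{perm D}|%:R^-1 * 1.
have uG : K - mu = dot u G.
  rewrite /u dotBl dotZl (dotZl _ (fun=> 1)) -KE -muE.
  by rewrite !mulKf ?gt_eqF.
have one : dot (fun _ : {perm D} => 1) (fun=> 1) = #|{perm D}|%:R :> R.
  by rewrite -[RHS]sumr_const; apply: eq_bigr => s _; rewrite mulr1.
have uu : dot u u * #|{perm D}|%:R <= X - 1.
  have -> : dot u u * #|{perm D}|%:R =
      #|{perm D}|%:R / H ^+ 2 * dot (iter t P h) (iter t P h) - 1.
    rewrite /u dotBl !dotBr !dotZl !dotZr.
    rewrite (dotC (fun=> 1) (iter t P h)) h1 one.
    by field; rewrite !gt_eqF.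
  rewrite lerD2r -ler_pdivlMl ?divr_gt0 ?exprn_gt0 //.
  by rewrite invf_div mulrC.
have GG : dot G G <= #|{perm D}|%:R.
  rewrite -one; apply: ler_sum => s _; rewrite /G /F mulr1.
  by case: (_ \in A); rewrite ?mulr1 ?mul0r.
rewrite -(sqrtr_sqr (K - mu)) ler_wsqrtr // uG.
apply: le_trans (dot_sqr_le _ _) _; apply: le_trans uu.
by rewrite ler_wpM2l ?dot_ge0.
Qed.



                                       

(** * The second-moment lower bound *)

Section TestFunction.
Variables (w : 'I_n -> R) (v0 : 'I_Q).
Hypothesis w_sum : \sum_i w i = 0.
Hypothesis w_le1 : forall i, w i ^+ 2 <= 1.

Definition test (r : config Q kappa n) : R := \sum_i w i * (val r i == v0)%:R.

Let F s := test (cfg s).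
Let hit s z : R := (st (s z) == v0)%:R.
Let rate : R := 1 - lag R labels / n%:R.

Lemma testE s : F s = \sum_i w i * hit s (lab i).
Proof. by apply: eq_bigr => i _; rewrite /= ffunE. Qed.

Lemma test_fixing (g s : {perm D}) : g \in fixing labels -> F (g * s)%g = F s.
Proof.
move=> /fixingP gL; rewrite !testE; apply: eq_bigr => i _.
by rewrite /hit permM gL // mem_labels.
Qed.

Lemma test_tperm s i e : e \in ~: others i ->
  F (tperm (lab i) e * s)%g = F s + w i * (hit s e - hit s (lab i)).
Proof.
move=> eo; rewrite /F /test.
rewrite (bigD1 i) //= [in RHS](bigD1 i) //= (stations_tperm s eo) !ffunE eqxx.
rewrite (eq_bigr (fun j => w j * (stations s j == v0)%:R)) => [|j ji].
  by rewrite /hit; ring.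
by rewrite ffunE (negPf ji).
Qed.

Lemma card_others i : #|~: others i|%:R = #|~: labels|.+1%:R :> R.
Proof. by rewrite /others finset.setCD finset.setUC cardsU1 inE mem_labels. Qed.

Lemma hit_sum_others s i : \sum_(e in ~: others i) hit s e =
  kappa%:R - \sum_j hit s (lab j) + hit s (lab i).
Proof.
have total : \sum_z hit s z = kappa%:R.
  rewrite /hit -natr_sum -(card_perm_st card_st s v0) -sum1dep_card; congr (_%:R).
  by rewrite [RHS]big_mkcond; apply: eq_bigr => z _; case: eqP.
have lab_sum : \sum_j hit s (lab j) = hit s (lab i) + \sum_(e in others i) hit s e.
  rewrite -(big_setD1 _ (mem_labels i)) /= big_imset //.
  by move=> j k _ _; exact: lab_inj.
rewrite -total lab_sum (bigID (mem (others i)) predT) /=.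
rewrite [LHS](eq_bigl (fun z => z \notin others i)) => [|z]; last by rewrite /= inE.
by ring.
Qed.

Lemma avg_testE (G : R -> R) i s :
  #|~: labels|.+1%:R * avg (others i) (fun s => G (F s)) s =
  \sum_(e in ~: others i) G (F s + w i * (hit s e - hit s (lab i))).
Proof.
rewrite -(card_others i) avg_setD1_sum ?mem_labels //; last first.
  by move=> g s' gL; rewrite test_fixing.
by apply: eq_bigr => e eo; rewrite test_tperm.
Qed.

(** The expected change from refreshing i contains w_i times the number of free slots at v0, which
    does not depend on i; since the weights sum to zero these terms cancel, and only a multiple of F
    remains. *)
Lemma refresh_test : refresh labels F =1 fun s => rate * F s.
Proof.
move=> s; rewrite refresh_labelsE.
have m0 : #|~: labels|.+1%:R != 0 :> R by rewrite pnatr_eq0.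
have E i : avg (others i) F s = F s + #|~: labels|.+1%:R^-1 *
    (w i * (kappa%:R - \sum_j hit s (lab j)) -
     #|~: labels|%:R * (w i * hit s (lab i))).
  apply: (mulfI m0); rewrite (avg_testE id) big_split /= -mulr_sumr sumrB.
  rewrite hit_sum_others !sumr_const -[F s *+ _]mulr_natl -[hit _ _ *+ _]mulr_natl.
  by rewrite card_others -natr1; field; rewrite natr1.
rewrite (eq_bigr _ (fun i _ => E i)) big_split /= sumr_const card_ord.
rewrite -mulr_sumr sumrB -mulr_suml w_sum mul0r -mulr_sumr -testE.
rewrite -[F s *+ n]mulr_natl /rate /lag.
have n0 : n%:R != 0 :> R by rewrite pnatr_eq0 -lt0n.
by field; rewrite n0 nat1r m0.
Qed.

(** A step changes F by at most 1 in absolute value, so its square grows on average by at most 2F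
    times the mean change, plus 1. *)
Lemma refresh_test_sqr s :
  refresh labels (fun s => F s ^+ 2) s <= (2 * rate - 1) * F s ^+ 2 + 1.
Proof.
have m0 : 0 < #|~: labels|.+1%:R :> R by rewrite ltr0n.
have nR0 : 0 < n%:R :> R by rewrite ltr0n.
have E i : avg (others i) (fun s => F s ^+ 2) s <=
    2 * F s * avg (others i) F s + (1 - F s ^+ 2).
  rewrite -(ler_pM2l m0) mulrDr (mulrCA _ (2 * F s)).
  rewrite (avg_testE (fun x => x ^+ 2)) (avg_testE id) mulr_sumr.
  rewrite -(card_others i) [_ * (1 - _)]mulr_natl -sumr_const -big_split /=.
  apply: ler_sum => e _; rewrite /hit; have := w_le1 i.
  set a := _%:R - _%:R.
  have a2 : a ^+ 2 <= 1 by rewrite /a; do 2![case: eqP => _]; rewrite /=; lra.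
  have -> : 2 * F s * (F s + w i * a) + (1 - F s ^+ 2) =
    (F s + w i * a) ^+ 2 + (1 - w i ^+ 2 * a ^+ 2) by ring.
  move=> w1; rewrite lerDl subr_ge0 mulr_ile1 ?sqr_ge0 //.
have PF := refresh_test s.
rewrite refresh_labelsE in PF.
rewrite refresh_labelsE ler_pdivrMl //.
apply: le_trans (ler_sum _ (fun i _ => E i)) _.
rewrite big_split /= -mulr_sumr sumr_const card_ord -[X in _ + X]mulr_natl.
move/(congr1 (fun x => n%:R * x)): PF; rewrite mulVKf ?gt_eqF // => ->.
by rewrite le_eqVlt; apply/orP; left; apply/eqP; ring.
Qed.

Hypothesis lag_ge : 2^-1 <= lag R labels.
Hypothesis n_gt1 : (1 < n)%N.

Let nR0 : 0 < n%:R :> R. Proof. by rewrite ltr0n. Qed.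

Lemma rate_sqr_bounds : 0 <= 2 * rate - 1 <= rate ^+ 2.
Proof.
apply/andP; split; last by have := sqr_ge0 (rate - 1); lra.
have : lag R labels / n%:R <= 2^-1.
  rewrite ler_pdivrMr // (le_trans (lag_le1 _ _)) // ler_pdivlMl // mulr1.
  by rewrite ler_nat.
rewrite /rate; lra.
Qed.

(** Makes n a supersolution of the second-moment recursion x -> (2 rate - 1) x + 1; this is where
    [lag] >= 1/2 is needed. *)
Lemma rate_gap : (2 * rate - 1) * n%:R + 1 <= n%:R.
Proof.
rewrite /rate.
have -> : (2 * (1 - lag R labels / n%:R) - 1) * n%:R = n%:R - 2 * lag R labels.
  by field; rewrite gt_eqF.
have : 1 <= 2 * lag R labels by rewrite -ler_pdivrMl // mulr1.
lra.
Qed.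

Lemma law_at_ge0 t (c r : config Q kappa n) : 0 <= law_at R t c r.
Proof.
have g0 r1 r2 : 0 <= glauber R r1 r2 :> R.
  apply: sumr_ge0 => i _; rewrite mulr_ge0 ?invr_ge0 // /gibbs_cond.
  case: ifP => // _; apply: divr_ge0; first by rewrite ltW ?gibbs_gt0.
  by apply: sumr_ge0 => r3 _; rewrite ltW ?gibbs_gt0.
elim: t r => [|t IH] r /=; first by case: (_ == _).
by apply: sumr_ge0 => r1 _; rewrite mulr_ge0.
Qed.

Lemma law_at_sum t (c : config Q kappa n) : \sum_r law_at R t c r = 1.
Proof.
have [s <-] := cfg_surj c.
have := law_at_cfg t (fun=> 1) s; rewrite iter_refresh_const1 => <-.
by apply: eq_bigr => r _; rewrite mulr1.
Qed.

Lemma law_at_test t (c : config Q kappa n) :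
  \sum_r law_at R t c r * test r = rate ^+ t * test c.
Proof.
have [s <-] := cfg_surj c.
elim: t => [|t IH].
  by rewrite (bigD1 (cfg s)) //= eqxx !mul1r big1 ?addr0 // => r /negPf ->; rewrite mul0r.
rewrite law_at_cfg iterSr.
have -> : refresh labels (fun s => test (cfg s)) =
    fun s => (fun r => rate * test r) (cfg s) by apply/funext => s'; exact: refresh_test.
rewrite -(law_at_cfg t (fun r => rate * test r)) exprS -mulrA -IH mulr_sumr.
by apply: eq_bigr => r _; rewrite mulrCA.
Qed.

(** In other words the variance at time t is at most n; the squared mean is propagated by 2 rate - 1
    <= rate^2. *)
Lemma law_at_test_sqr t (c : config Q kappa n) :
  \sum_r law_at R t c r * test r ^+ 2 <= (rate ^+ t * test c) ^+ 2 + n%:R.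
Proof.
have [s <-] := cfg_surj c.
elim: t => [|t IH].
  rewrite (bigD1 (cfg s)) //= eqxx !mul1r big1 ?addr0 ?lerDl // => r /negPf ->.
  by rewrite mul0r.
rewrite law_at_cfg iterSr.
have -> : refresh labels (fun s => test (cfg s) ^+ 2) =
    fun s => (fun r => \sum_r' glauber R r r' * test r' ^+ 2) (cfg s).
  by apply/funext => s'; exact: refresh_cfg.
rewrite -(law_at_cfg t (fun r => \sum_r' glauber R r r' * test r' ^+ 2)).
apply: le_trans (_ : \sum_r law_at R t (cfg s) r * ((2 * rate - 1) * test r ^+ 2 + 1) <= _).
  apply: ler_sum => r _; rewrite ler_wpM2l ?law_at_ge0 //.
  have [s' <-] := cfg_surj r.
  by rewrite -(refresh_cfg (fun r => test r ^+ 2)); exact: refresh_test_sqr.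
rewrite (eq_bigr (fun r => (2 * rate - 1) * (law_at R t (cfg s) r * test r ^+ 2) +
  law_at R t (cfg s) r)) => [|r _]; last by ring.
rewrite big_split /= -mulr_sumr law_at_sum.
have /andP[r0 r1] := rate_sqr_bounds.
apply: le_trans (lerD (ler_wpM2l r0 IH) (lexx 1)) _.
rewrite mulrDr -addrA lerD ?rate_gap //.
have -> : (rate ^+ t.+1 * test (cfg s)) ^+ 2 = rate ^+ 2 * (rate ^+ t * test (cfg s)) ^+ 2.
  by rewrite [rate ^+ t.+1]exprS -mulrA exprMn.
by rewrite ler_wpM2r ?sqr_ge0.
Qed.

(** Stationarity turns the one-step bound into T <= (2 rate - 1) T + 1 for the equilibrium second
    moment T, up to normalisation. *)
Lemma gibbs_test_sqr : \sum_r gibbs R r * test r ^+ 2 <= n%:R.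
Proof.
have P0 : 0 < #|{perm D}|%:R :> R by rewrite ltr0n; apply/card_gt0P; exists 1%g.
rewrite -(ler_pM2l P0) -sum_cfg.
set T := \sum_s _.
have TE : T = \sum_s refresh labels (fun s => F s ^+ 2) s.
  transitivity (dot (refresh labels (fun=> 1)) (fun s => F s ^+ 2)).
    by rewrite refresh_const1; apply: eq_bigr => s _; rewrite mul1r.
  by rewrite dot_refresh; apply: eq_bigr => s _; rewrite mul1r.
have : T <= \sum_s ((2 * rate - 1) * F s ^+ 2 + 1).
  by rewrite {1}TE; apply: ler_sum => s _; exact: refresh_test_sqr.
rewrite big_split /= -mulr_sumr -/T sumr_const => le.
have T0 : 0 <= T by apply: sumr_ge0 => s _; exact: sqr_ge0.
have /andP[r0 _] := rate_sqr_bounds; have := rate_gap.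
move: le P0 nR0 T0 r0; set p := #|{perm D}|%:R; set x := n%:R; set q := 2 * rate - 1.
move=> le p0 x0 T0 q0 gap.
have : T * (1 - q) <= p by lra.
move=> le'; have : T * (x * (1 - q)) <= p * x by nra.
have : 1 <= x * (1 - q) by lra.
nra.
Qed.

(** Chebyshev on both sides of the threshold a: the law at time t has mean 2a and equilibrium has
    second moment at most n, so each misplaces mass at most n / a^2. *)
Lemma dTV_ge t (c : config Q kappa n) (a : R) : 0 < a -> rate ^+ t * test c = 2 * a ->
  1 - 2 * n%:R / a ^+ 2 <= dTV R Q kappa n t.
Proof.
move=> a0 aE.
pose A := [set r | a <= test r].
have a20 : 0 < a ^+ 2 by rewrite exprn_gt0.
have lawA : (1 - \sum_(r in A) law_at R t c r) * a ^+ 2 <= n%:R.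
  rewrite -[X in X - _](law_at_sum t c) (bigID (mem A)) /= addrAC subrr add0r mulr_suml.
  apply: le_trans (_ : \sum_r law_at R t c r * (test r - 2 * a) ^+ 2 <= _).
    rewrite big_mkcond; apply: ler_sum => r _.
    rewrite inE; case: (leP a (test r)) => /= ra; first by rewrite mulr_ge0 ?law_at_ge0 ?sqr_ge0.
    by rewrite ler_wpM2l ?law_at_ge0 //; nra.
  rewrite (eq_bigr (fun r => law_at R t c r * test r ^+ 2 -
    4 * a * (law_at R t c r * test r) + 4 * a ^+ 2 * law_at R t c r)) => [|r _]; last by ring.
  rewrite big_split sumrB /= -!mulr_sumr law_at_test law_at_sum aE.
  by have := law_at_test_sqr t c; rewrite aE; lra.
have gibbsA : (\sum_(r in A) gibbs R r) * a ^+ 2 <= n%:R.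
  apply: le_trans gibbs_test_sqr; rewrite mulr_suml big_mkcond.
  apply: ler_sum => r _; rewrite inE; case: (leP a (test r)) => [ra|_].
    by apply: ler_wpM2l; [rewrite ltW ?gibbs_gt0|nra].
  by rewrite mulr_ge0 ?sqr_ge0 // ltW ?gibbs_gt0.
apply: le_trans (le_bigmax _ _ c); apply: le_trans (le_bigmax _ _ A).
apply: le_trans (ler_norm _).
rewrite -(ler_pM2r a20) mulrBl divfK ?gt_eqF // mulrBl.
lra.
Qed.

End TestFunction.

End Lift.

                                       

(** * Evaluating the bounds near time n log n / 2 *)

Lemma pow_decay_le (R : realType) (c delta : R) (n m t : nat) :
    1 < c -> 0 < delta -> (0 < n)%N -> (n <= m)%N ->
    2^-1 * n%:R * ln n%:R + (c - 1) * expR 1 / delta * n%:R <= t%:R ->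
  (1 + (c - 1) * (1 - m%:R / m.+1%:R / n%:R) ^+ t.*2) ^+ n <= expR delta.
Proof.
move=> c1 d0 n0 nm.
set C := (c - 1) * expR 1 / delta; set theta := m%:R / m.+1%:R => tge.
have nR : 0 < n%:R :> R by rewrite ltr0n.
have e0 : 0 < expR 1 :> R := expR_gt0 _.
have C0 : 0 < C by rewrite divr_gt0 // mulr_gt0 // subr_gt0.
have mR : 0 < m.+1%:R :> R by rewrite ltr0n.
have theta01 : 0 <= theta <= 1.
  by rewrite divr_ge0 //= ler_pdivrMr // mul1r ler_nat.
have n1 : 1 <= n%:R :> R by rewrite ler1n.
have base0 : 0 <= 1 - theta / n%:R.
  by rewrite subr_ge0 ler_pdivrMr // mul1r; case/andP: theta01 => _; lra.
have lnn : 0 <= ln (n%:R : R) <= n%:R.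
  by rewrite ln_ge0 //= (le_trans (ltW (ln_sublinear _))).
have decay : (1 - theta / n%:R) ^+ t.*2 <= expR (1 - C) / n%:R.
  apply: (@le_trans _ _ (expR (- (theta / n%:R)) ^+ t.*2)).
    by rewrite lerXn2r ?nnegrE ?expR_ge0 // expR_ge1Dx.
  rewrite -expRM_natl -{2}(lnK (x := n%:R)) ?posrE // -expRN -expRD ler_expR.
  have -> : t.*2%:R = 2 * t%:R :> R by rewrite -muln2 natrM mulrC.
  rewrite mulrN lerNl.
  have tn : ln n%:R + 2 * C <= 2 * t%:R / n%:R.
    by rewrite ler_pdivlMr //; lra.
  have thetaE : theta = 1 - m.+1%:R^-1.
    by rewrite /theta -natr1; field; rewrite natr1 gt_eqF.
  (* The cost of theta = 1 - 1/(m+1) instead of 1: ln n <= n <= m accounts for the 1, and m >= 1 for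
     the C. *)
  have small : (ln n%:R + 2 * C) / m.+1%:R <= 1 + C.
    rewrite ler_pdivrMr // -natr1.
    have mn : n%:R <= m%:R :> R by rewrite ler_nat.
    by case/andP: lnn => _ ?; nra.
  have -> : 2 * t%:R * (theta / n%:R) = theta * (2 * t%:R / n%:R) by ring.
  case/andP: theta01 => th0 _.
  apply: le_trans (ler_wpM2l th0 tn).
  rewrite thetaE mulrBl mul1r [_^-1 * _]mulrC.
  by move: small; set q := _ / m.+1%:R; lra.
apply: (@le_trans _ _ ((1 + (c - 1) * (expR (1 - C) / n%:R)) ^+ n)).
  have c0 : 0 <= c - 1 by rewrite subr_ge0 ltW.
  apply: lerXn2r; rewrite ?nnegrE.
  - by rewrite addr_ge0 // mulr_ge0 // exprn_ge0.
  - by rewrite addr_ge0 // mulr_ge0 // divr_ge0 ?expR_ge0.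
  - by rewrite lerD2l ler_wpM2l.
apply: (@le_trans _ _ (expR ((c - 1) * (expR (1 - C) / n%:R)) ^+ n)).
  apply: lerXn2r; rewrite ?nnegrE ?expR_ge0 ?expR_ge1Dx //.
  by rewrite addr_ge0 // mulr_ge0 ?subr_ge0 ?(ltW c1) // divr_ge0 ?expR_ge0.
rewrite -expRM_natl ler_expR.
have -> : n%:R * ((c - 1) * (expR (1 - C) / n%:R)) = (c - 1) * expR (1 - C).
  by field; rewrite gt_eqF.
rewrite expRD expRN.
(* C was chosen so that (c-1) e / C = delta. *)
have : (expR C)^-1 <= C^-1.
  by rewrite lef_pV2 ?posrE ?expR_gt0 //; have := expR_ge1Dx C; lra.
move=> /(ler_wpM2l (ltW e0)) le.
have c0 : 0 <= c - 1 by rewrite subr_ge0 ltW.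
apply: le_trans (ler_wpM2l c0 le) _; rewrite le_eqVlt; apply/orP; left; apply/eqP.
by rewrite /C; field; rewrite !gt_eqF // subr_gt0.
Qed.

(** Uses 1 - 1/n >= exp(-1/(n-1)); replacing t/n by t/(n-1) adds at most 1/2 to the exponent because
    ln n <= n - 1. *)
Lemma pow_decay_ge (R : realType) (C : R) (n t : nat) (rate : R) :
    (1 < n)%N -> 1 - n%:R^-1 <= rate -> 0 <= C ->
    t%:R <= 2^-1 * n%:R * ln n%:R - C * n%:R ->
  expR (2 * C - 1) / n%:R <= (rate ^+ t) ^+ 2.
Proof.
move=> n1 rate_ge C0 tle.
have nR : 1 < n%:R :> R by rewrite ltr1n.
have nR0 : 0 < n%:R :> R by lra.
have n10 : 0 < n%:R - 1 :> R by lra.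
have one_sub : expR (- (n%:R - 1)^-1) <= 1 - n%:R^-1 :> R.
  rewrite expRN -[leRHS]invrK lef_pV2 ?posrE ?expR_gt0 //; last first.
    by rewrite invr_gt0 subr_gt0 invf_lt1.
  apply: le_trans (expR_ge1Dx _).
  rewrite le_eqVlt; apply/orP; left; apply/eqP; field.
  by rewrite !gt_eqF.
have pow : expR (- (n%:R - 1)^-1) ^+ t <= rate ^+ t.
  rewrite lerXn2r ?nnegrE ?expR_ge0 //; last exact: le_trans rate_ge.
  by apply: le_trans rate_ge; apply: le_trans one_sub; exact: expR_ge0.
apply: le_trans (_ : (expR (- (n%:R - 1)^-1) ^+ t) ^+ 2 <= _); last first.
  rewrite lerXn2r ?nnegrE ?exprn_ge0 ?expR_ge0 //.
  by apply: le_trans rate_ge; apply: le_trans one_sub; exact: expR_ge0.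
rewrite -!expRM_natl -{1}(lnK (x := n%:R)) ?posrE // -expRN -expRD ler_expR.
have ln_le : ln n%:R <= n%:R - 1 :> R.
  have E : 1 + (n%:R - 1) = n%:R :> R by lra.
  by have := @le_ln1Dx R (n%:R - 1); rewrite E; apply; lra.
have tn : t%:R / (n%:R - 1) <= 2^-1 * ln n%:R - C + 2^-1.
  rewrite ler_pdivrMr //.
  have t0 : 0 <= t%:R :> R by [].
  nra.
rewrite mulrN mulrN; lra.
Qed.

(** * An evenly spread starting configuration for the lower bound *)

Section RoundRobin.
Variables (Q n : nat).
Hypothesis Q_gt0 : (0 < Q)%N.

Definition round_robin : {ffun 'I_n -> 'I_Q} :=
  [ffun i : 'I_n => Ordinal (ltn_pmod i Q_gt0)].

Lemma occupancy_round_robin_le kappa (v : 'I_Q) : (n <= kappa * Q)%N ->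
  (occupancy round_robin v <= kappa)%N.
Proof.
move=> nk.
have lt (i : 'I_n) : (i %/ Q < kappa)%N by rewrite ltn_divLR // (leq_trans _ nk).
pose f i := Ordinal (lt i).
rewrite -[leqRHS]card_ord /occupancy -(card_in_imset (f := f)) ?max_card // => i j.
rewrite !inE !ffunE => /eqP iv /eqP jv /(congr1 val) /= ij; apply: val_inj => /=.
rewrite (divn_eq i Q) (divn_eq j Q) ij.
by have := etrans (congr1 val iv) (esym (congr1 val jv)) => /= ->.
Qed.

Lemma occupancy_round_robin_ge (v : 'I_Q) :
  (n %/ Q <= occupancy round_robin v)%N.
Proof.
have lt (j : 'I_(n %/ Q)) : (j * Q + v < n)%N.
  apply: (@leq_trans (j.+1 * Q)); first by rewrite mulSn addnC ltn_add2r.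
  by apply: leq_trans (leq_divM n Q); rewrite leq_mul2r ltn_ord orbT.
pose f j := Ordinal (lt j).
have f_inj : injective f.
  move=> i j /(congr1 val) /= /addIn /eqP; rewrite eqn_pmul2r // => /eqP.
  exact: val_inj.
rewrite -[leqLHS]card_ord -(card_imset _ f_inj) subset_leq_card //.
apply/fintype.subsetP => _ /imsetP[j _ ->]; rewrite inE ffunE.
by apply/eqP/val_inj; rewrite /= modnMDl modn_small.
Qed.

Lemma occupancy_round_robin_compl (v v' : 'I_Q) : v != v' ->
  (n %/ Q + occupancy round_robin v <= n)%N.
Proof.
move=> vv'; apply: leq_trans (_ : \sum_u occupancy round_robin u <= n)%N; last first.
  by rewrite sum_occupancy.
rewrite (bigD1 v) //= (bigD1 v') 1?eq_sym //= addnC leq_add2l.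
by rewrite (leq_trans (occupancy_round_robin_ge v')) // leq_addr.
Qed.

End RoundRobin.

(** Centring the indicator of station v in the starting configuration yields admissible weights
    whose test value is of order n as soon as both v and its complement hold a positive fraction of
    the particles. *)
Lemma deviation_weights (R : realType) (n Q : nat) (c : {ffun 'I_n -> 'I_Q}) (v : 'I_Q) :
    (0 < n)%N ->
  let x : R := (occupancy c v)%:R in
  let w (i : 'I_n) : R := (c i == v)%:R - x / n%:R in
  [/\ \sum_i w i = 0, forall i, w i ^+ 2 <= 1 &
      \sum_i w i * (c i == v)%:R = x * (n%:R - x) / n%:R].
Proof.
move=> n0 x w.
have nR : 0 < n%:R :> R by rewrite ltr0n.
have xE : \sum_i (c i == v)%:R = x :> R.
  rewrite -natr_sum /x /occupancy -sum1dep_card [in RHS]big_mkcond.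
  by congr (_%:R); apply: eq_bigr => i _; case: eqP.
have xn : 0 <= x / n%:R <= 1.
  rewrite divr_ge0 //= ler_pdivrMr // mul1r ler_nat -[leqRHS]card_ord.
  exact: max_card.
split.
- by rewrite sumrB xE sumr_const card_ord -[_ *+ n]mulr_natr divfK ?subrr ?gt_eqF.
- move=> i; rewrite /w; case/andP: xn; set y := x / n%:R.
  by case: eqP => _ /=; nra.
- rewrite (eq_bigr (fun i => (1 - x / n%:R) * (c i == v)%:R)) => [|i _].
    by rewrite -mulr_sumr xE; field; rewrite gt_eqF.
  by rewrite /w; case: eqP => _; rewrite ?mulr1 ?mulr0.
Qed.

(** * The concrete slots: pairs of a station and a place in it *)

Section Slots.
Variables (Q kappa n : nat).
Hypothesis n_le : (n <= kappa * Q)%N.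

Lemma card_slot_station (v : 'I_Q) : #|[set z : 'I_Q * 'I_kappa | z.1 == v]| = kappa.
Proof.
have -> : [set z : 'I_Q * 'I_kappa | z.1 == v] = finset.setX [set v] [set: 'I_kappa].
  by apply/setP => -[u k]; rewrite !inE andbT.
by rewrite cardsX cards1 finset.cardsT card_ord mul1n.
Qed.

Lemma n_le_card_slots : (n <= #|{: 'I_Q * 'I_kappa}|)%N.
Proof. by rewrite card_prod !card_ord mulnC. Qed.

Definition slot (i : 'I_n) : 'I_Q * 'I_kappa :=
  enum_val (widen_ord n_le_card_slots i).

Lemma slot_inj : injective slot.
Proof. by move=> i j /enum_val_inj /(congr1 val) /= ij; exact: val_inj. Qed.

Lemma card_free_slots : #|~: labels slot| = (kappa * Q - n)%N.
Proof.
have sites : (kappa * Q = #|labels slot| + #|~: labels slot|)%N.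
  by rewrite cardsC card_prod !card_ord mulnC.
by rewrite sites (card_labels slot_inj) addKn.
Qed.

End Slots.

(** * The two sides of the window, and the theorem *)

Lemma dTV_le_of_large (R : realType) (Q kappa n t : nat) (eps : R) :
    (2 <= Q)%N -> (0 < n)%N -> (n.*2 <= kappa * Q)%N -> 0 < eps ->
    2^-1 * n%:R * ln n%:R +
      (Q%:R * expR 1 - 1) * expR 1 / ln (1 + eps ^+ 2) * n%:R <= t%:R ->
  dTV R Q kappa n t <= eps.
Proof.
move=> Q2 n0 n2 eps0 tge.
have n_le : (n <= kappa * Q)%N by rewrite (leq_trans _ n2) // -addnn leq_addr.
apply: le_trans (dTV_le _ (@card_slot_station Q kappa) (@slot_inj Q kappa n n_le) n0 t) _.
rewrite -[leRHS]ger0_norm ?(ltW eps0) // -sqrtr_sqr ler_wsqrtr // lerBlDl.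
rewrite /lag card_free_slots.
have e20 : 0 < 1 + eps ^+ 2 by rewrite addr_gt0 ?exprn_gt0.
rewrite -(lnK (x := 1 + eps ^+ 2)) ?posrE //.
apply: pow_decay_le => //.
- have : 2 <= Q%:R :> R by rewrite ler_nat.
  by have := @expR_ge1Dx R 1; nra.
- by rewrite ln_gt0 // ltrDl exprn_gt0.
- by rewrite leq_subRL // addnn.
Qed.

(** The round-robin start gives a test value y >= n/(4 Q^2), whence a^2 >= n e^(2C-1)/(64 Q^4). The
    constant 128 makes (1 - eps) a^2 exceed 4n, more than the 2n that [dTV_ge] asks for. *)
Lemma dTV_gt_of_small (R : realType) (Q kappa n t : nat) (eps : R) :
    (2 <= Q)%N -> (1 < n)%N -> (Q <= n)%N -> (n.*2 <= kappa * Q)%N ->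
    0 < eps -> eps < 1 ->
    t%:R <= 2^-1 * n%:R * ln n%:R - 128 * Q%:R ^+ 4 * expR 1 / (1 - eps) * n%:R ->
  eps < dTV R Q kappa n t.
Proof.
move=> Q2 n1 Qn n2 eps0 eps1.
set C := _ * expR 1 / (1 - eps) => tle.
have n0 : (0 < n)%N := ltnW n1.
have Q0 : (0 < Q)%N := ltnW Q2.
have n_le : (n <= kappa * Q)%N by rewrite (leq_trans _ n2) // -addnn leq_addr.
pose c0 : config Q kappa n := exist _ (round_robin n Q0)
  (introT forallP (fun v => occupancy_round_robin_le Q0 v n_le)).
pose v0 := Ordinal Q0; pose v1 := Ordinal Q2.
pose x : R := (occupancy (val c0) v0)%:R.
have [w_sum w_le test_c0] := deviation_weights R (val c0) v0 n0.
have nR : 0 < n%:R :> R by rewrite ltr0n.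
have QR : 0 < Q%:R :> R by rewrite ltr0n.
pose p : R := (n %/ Q)%:R.
have p_ge : n%:R / (2 * Q%:R) <= p.
  rewrite ler_pdivrMr ?mulr_gt0 // mulrA -!natrM ler_nat.
  have p1 : (1 <= n %/ Q)%N by rewrite divn_gt0.
  (* Since n >= Q, the quotient is at least 1, so rounding down loses at most a factor 2. *)
  apply: leq_trans (ltnW (ltn_ceil n Q0)) _.
  by rewrite leq_mul2r; apply/orP; right; lia.
have p0 : 0 < p by apply: lt_le_trans p_ge; rewrite divr_gt0 // mulr_gt0.
have px : p <= x by rewrite ler_nat occupancy_round_robin_ge.
have pnx : p <= n%:R - x.
  rewrite lerBrDr -natrD ler_nat.
  exact: (@occupancy_round_robin_compl Q n Q0 v0 v1).
pose y := x * (n%:R - x) / n%:R.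
have y_ge : n%:R / (4 * Q%:R ^+ 2) <= y.
  rewrite /y ler_pdivlMr //.
  apply: le_trans (_ : p * p <= _); last by rewrite ler_pM // ltW.
  apply: le_trans (_ : n%:R / (2 * Q%:R) * (n%:R / (2 * Q%:R)) <= _); last first.
    by rewrite ler_pM // ltW // divr_gt0 // mulr_gt0.
  by rewrite le_eqVlt; apply/orP; left; apply/eqP; field; rewrite gt_eqF.
have y0 : 0 < y by apply: lt_le_trans y_ge; rewrite divr_gt0 // mulr_gt0 ?exprn_gt0.
have C0 : 0 < C.
  by rewrite /C divr_gt0 ?subr_gt0 // !mulr_gt0 ?exprn_gt0 ?expR_gt0.
set m := (kappa * Q - n)%N.
have nm : (n <= m)%N by rewrite leq_subRL // addnn.
pose rate : R := 1 - lag R (labels (slot n_le)) / n%:R.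
have lagE : lag R (labels (slot n_le)) = m%:R / m.+1%:R by rewrite /lag card_free_slots.
have rate_ge : 1 - n%:R^-1 <= rate.
  by rewrite /rate lerD2l lerN2 -[leRHS]mul1r ler_wpM2r ?invr_ge0 // lag_le1.
have rate0 : 0 < rate.
  by apply: lt_le_trans rate_ge; rewrite subr_gt0 invf_lt1 // ltr1n.
pose a := rate ^+ t * y / 2.
have a0 : 0 < a by rewrite divr_gt0 // mulr_gt0 // exprn_gt0.
have aE : rate ^+ t * test (fun i => (val c0 i == v0)%:R - x / n%:R) v0 c0 = 2 * a.
  rewrite /test test_c0 -/x -/y /a; lra.
have lag_ge : 2^-1 <= lag R (labels (slot n_le)).
  rewrite lagE ler_pdivlMr ?ltr0n // ler_pdivrMl // -natrM ler_nat.
  by rewrite mul2n -addnn -addn1 leq_add2l (leq_trans n0).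
apply: lt_le_trans (dTV_ge (@card_slot_station Q kappa) (@slot_inj Q kappa n n_le) n0
  w_sum w_le lag_ge n1 a0 aE).
have a2 : n%:R * expR (2 * C - 1) / (64 * Q%:R ^+ 4) <= a ^+ 2.
  have := pow_decay_ge n1 rate_ge (ltW C0) tle.
  set e := expR _ => rt.
  have -> : a ^+ 2 = (rate ^+ t) ^+ 2 * (y ^+ 2 / 4) by rewrite /a; field.
  apply: le_trans (_ : e / n%:R * ((n%:R / (4 * Q%:R ^+ 2)) ^+ 2 / 4) <= _).
    by rewrite le_eqVlt; apply/orP; left; apply/eqP; field; rewrite !gt_eqF.
  apply: ler_pM rt _.
  - by rewrite divr_ge0 ?expR_ge0.
  - by rewrite divr_ge0 ?sqr_ge0.
  - by rewrite ler_pM2r ?invr_gt0 // lerXn2r ?nnegrE ?(ltW y0).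
have e_ge : 2 * C / expR 1 < expR (2 * C - 1).
  rewrite expRD expRN ltr_pM2r ?invr_gt0 ?expR_gt0 //.
  by apply: lt_le_trans (expR_ge1Dx _); rewrite ltrDr.
have a2_gt : n%:R * (2 * C / expR 1) / (64 * Q%:R ^+ 4) < a ^+ 2.
  apply: lt_le_trans a2; rewrite ltr_pM2r ?ltr_pM2l //.
  by rewrite invr_gt0 mulr_gt0 ?exprn_gt0.
rewrite ltrBrDl -ltrBrDr ltr_pdivrMr ?exprn_gt0 //.
apply: le_lt_trans (_ : _ <= (1 - eps) * (n%:R * (2 * C / expR 1) / (64 * Q%:R ^+ 4))) _.
  have -> : (1 - eps) * (n%:R * (2 * C / expR 1) / (64 * Q%:R ^+ 4)) = 4 * n%:R.
    rewrite /C; field; rewrite !gt_eqF ?expR_gt0 ?subr_gt0 //.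
  lra.
by rewrite ltr_pM2l ?subr_gt0.
Qed.

Theorem theorem1p1 (R : realType) (Q : nat) (rho : R)
    (hQ : (2 <= Q)%N) (hrho0 : 0 < rho) (hrho1 : rho <= 2^-1)
    (eps : R) (heps0 : 0 < eps) (heps1 : eps < 1) :
  exists (C : R) (N0 : nat), forall (kappa n : nat),
    (1 <= kappa)%N ->
    n = Num.truncn (rho * (kappa * Q)%:R) ->
    (1 <= n)%N ->
    (N0 <= n)%N ->
    exists T : nat,
      is_mixing_time Q kappa n eps T /\
      `| T%:R - 2^-1 * n%:R * ln (n%:R) | <= C * n%:R.
Proof.
set C1 : R := (Q%:R * expR 1 - 1) * expR 1 / ln (1 + eps ^+ 2).
set C2 : R := 128 * Q%:R ^+ 4 * expR 1 / (1 - eps).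
have C1_ge0 : 0 <= C1.
  rewrite divr_ge0 ?ln_ge0 ?lerDl ?sqr_ge0 // mulr_ge0 ?expR_ge0 // subr_ge0.
  have : 2 <= Q%:R :> R by rewrite ler_nat.
  by have := @expR_ge1Dx R 1; nra.
have C2_ge0 : 0 <= C2.
  by rewrite divr_ge0 ?mulr_ge0 ?exprn_ge0 ?expR_ge0 // subr_ge0 ltW.
(* C1 and C2 come from the upper and lower bounds, and the 1 pays for rounding the time up to an
   integer. The threshold Q puts a particle at every station of the round-robin start and gives n >=
   2. *)
exists (C1 + 1 + C2), Q => kappa n kappa1 nE n1 Qn.
(* The only use of rho <= 1/2: there are at least as many vacancies as particles. *)
have n2 : (n.*2 <= kappa * Q)%N.
  have : n%:R <= rho * (kappa * Q)%:R.
    by rewrite nE truncn_le mulr_ge0 // ltW.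
  move=> /le_trans -/(_ _ (ler_wpM2r (ler0n _ _) hrho1)).
  by rewrite ler_pdivlMl // -natrM ler_nat mul2n.
set main := 2^-1 * n%:R * ln (n%:R : R).
have main_ge0 : 0 <= main by rewrite !mulr_ge0 ?invr_ge0 // ln_ge0 // ler1n.
have nR : 1 <= n%:R :> R by rewrite ler1n.
have up_ge0 : 0 <= main + C1 * n%:R by rewrite addr_ge0 // mulr_ge0.
pose T0 := (Num.truncn (main + C1 * n%:R)).+1.
have /andP[T0_ub T0_lb] := truncn_itv up_ge0.
have T0_small : dTV R Q kappa n T0 <= eps.
  by apply: dTV_le_of_large => //; apply: ltW.
have ex : exists t, dTV R Q kappa n t <= eps by exists T0.
case: (ex_minnP ex) => T T_small T_min.
exists T; split; first by split.
have TT0 : T%:R <= T0%:R :> R by rewrite ler_nat T_min.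
have T_ge : main - C2 * n%:R < T%:R.
  rewrite ltNge; apply/negP => T_le.
  have := dTV_gt_of_small hQ (leq_trans hQ Qn) Qn n2 heps0 heps1 T_le.
  by rewrite ltNge T_small.
have T0E : T0%:R = (Num.truncn (main + C1 * n%:R))%:R + 1 :> R by rewrite -natr1.
have : C1 * n%:R >= 0 by rewrite mulr_ge0.
have : C2 * n%:R >= 0 by rewrite mulr_ge0.
by rewrite ler_norml !mulrDl mul1r; lra.
Qed.
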